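(* Let $g,n\ge 0$ be integers with $2g-2+n>0$. The graded semigroup algebra $\mathbb{C}[P_{g,n}]$ is generated by the lattice points in $P_{g,n}(1)$ and $P_{g,n}(2)$, and the ideal of relations on these generators is generated in degrees $\le 4$. That is, let $S$ be the polynomial ring over $\mathbb{C}$ with one variable of degree $1$ for each element of $P_{g,n}(1)$ and one variable of degree $2$ for each element of $P_{g,n}(2)$. Then the natural graded homomorphism $S\to\mathbb{C}[P_{g,n}]$ is surjective, and its kernel is generated by homogeneous elements of degree $\le 4$.
   Context: Graphs. $\Gamma(0,n)$ ($n\ge 3$) is a fixed trivalent tree with $n$ leaves. $\Gamma(1,1)$ has a single trivalent vertex, carrying one loop edge and one leaf edge. For $g\ge 2$, $\Gamma(g,1)$ is the chain with trivalent vertices $v_1,a_2,b_2,\dots,a_g,b_g$: a loop edge at $v_1$, an edge $v_1a_2$, two parallel edges between $a_i$ and $b_i$ for $2\le i\le g$, an edge $b_ia_{i+1}$ for $2\le i<g$, and a leaf edge at $b_g$. For $g\ge1$ and $n\ge 2$, $\Gamma(g,n)$ is obtained by gluing the leaf edge of $\Gamma(g,1)$ to one leaf edge of $\Gamma(0,n+1)$, the two becoming a single edge; it has $n$ leaves and first Betti number $g$. Polytopes. For an integer $L\ge 0$, $P_{g,n}(L)$ denotes the set of weightings of the edges (including leaf edges) of $\Gamma(g,n)$ by non-negative integers such that at each trivalent vertex $v$, with $w_1(v),w_2(v),w_3(v)$ the weights of the three incident edges (a loop is counted twice), one has (i) $w_1(v)+w_2(v)+w_3(v)\le 2L$, (ii)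 $|w_1(v)-w_2(v)|\le w_3(v)\le w_1(v)+w_2(v)$, (iii) $w_1(v)+w_2(v)+w_3(v)\in 2\mathbb{Z}$. For $n=0$, $P_{g,0}(L)$ is the set of elements of $P_{g,1}(L)$ having weight $0$ on the unique leaf edge. Semigroup. Edge-wise addition gives maps $P_{g,n}(L)\times P_{g,n}(K)\to P_{g,n}(L+K)$. $P_{g,n}=\bigsqcup_{L\ge 0}P_{g,n}(L)$ is the resulting graded semigroup (its elements are pairs consisting of a level $L$ and a weighting in $P_{g,n}(L)$, so the zero weighting is a distinct element in each level), and $\mathbb{C}[P_{g,n}]$ is its semigroup algebra, graded by level $L$. *)

(* Defs.v *)
From HB Require Import structures.
From mathcomp Require Import all_boot all_order all_algebra finmap.
From mathcomp Require Import zify.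
From mathcomp Require Import reals complex.
From mathcomp.multinomials Require Import monalg.

Set Implicit Arguments.
Unset Strict Implicit.
Unset Printing Implicit Defensive.

Import GRing.Theory IntDist.

(* Only the trivalent vertices are vertices here; [inc v] lists the edges     *)
(* carrying the three half-edges at [v] (a loop occurs twice, the order is    *)
(* irrelevant).  A leaf edge has a single half-edge: its univalent end is not *)
(* represented.                                                               *)
Record trigraph := TriGraph {
  vertex : finType;
  edge : finType;
  inc : vertex -> 3.-tuple edge
}.

Section TriGraphs.
Variable G : trigraph.
Implicit Types (e : edge G) (u v : vertex G).

Definition half_edges e : nat := \sum_(v : vertex G) count_mem e (inc v).

Definition is_leaf e : bool := half_edges e == 1.

(* The edge [e] joins [u] to [v]; a leaf edge joins no two vertices. *)
Definition joins e u v : bool :=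
  if u == v then 1 < count_mem e (inc u) else (e \in inc u) && (e \in inc v).

Fixpoint walk u (s : seq (edge G * vertex G)) v : bool :=
  if s is (e, u') :: s' then joins e u u' && walk u' s' v else u == v.

Definition connected_graph : Prop := forall u v, exists s, walk u s v.

(* No nonempty closed walk with pairwise distinct edges, so that loops and    *)
(* multiple edges count as cycles.                                            *)
Definition acyclic_graph : Prop :=
  forall u s, walk u s u -> uniq [seq x.1 | x <- s] -> s = [::].

Definition trivalent_tree (n : nat) : Prop :=
  [/\ forall e, 0 < half_edges e <= 2,
      connected_graph, acyclic_graph & #|[set e | is_leaf e]| = n].

End TriGraphs.

(* Gamma(h+1, 1).  Vertices: [None] is v_1, and [Some (i, false)],            *)
(* [Some (i, true)] are a_(i+2), b_(i+2).  Edges: [None] is the loop,         *)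
(* [Some (inr (i, _))] are the two parallel edges between a_(i+2) and         *)
(* b_(i+2), and [Some (inl j)] is the edge entering a_(j+2) if j < h and the  *)
(* leaf edge if j = h.                                                        *)
Definition chain_edge (h : nat) : finType :=
  option ('I_h.+1 + 'I_h * bool)%type.

Definition chain_link (h : nat) (j : 'I_h.+1) : chain_edge h := Some (inl j).

Definition chain_para (h : nat) (i : 'I_h) (b : bool) : chain_edge h :=
  Some (inr (i, b)).

Definition chain_inc (h : nat) (v : option ('I_h * bool)) :
    3.-tuple (chain_edge h) :=
  match v with
  | None => [tuple None; None; chain_link ord0]
  | Some (i, false) =>
      [tuple chain_link (widen_ord (leqnSn h) i);
             chain_para i false; chain_para i true]
  | Some (i, true) =>
      [tuple chain_para i false; chain_para i true;
             chain_link (lift ord0 i)]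
  end.

Definition chain (h : nat) : trigraph := TriGraph (@chain_inc h).

Definition chain_leaf (h : nat) : edge (chain h) := chain_link ord_max.

(* Gluing of the leaf edges [e1] and [e2]; the resulting edge is [inl e1]. *)
Section Glue.
Variables (G1 G2 : trigraph) (e1 : edge G1) (e2 : edge G2).

Definition glue_edge : finType := (edge G1 + {e : edge G2 | e != e2})%type.

Definition glue_edge2 (e : edge G2) : glue_edge :=
  if insub e is Some e' then inr e' else inl e1.

Definition glue_inc (v : vertex G1 + vertex G2) : 3.-tuple glue_edge :=
  match v with
  | inl v1 => [tuple of [seq inl e | e <- inc v1]]
  | inr v2 => [tuple of [seq glue_edge2 e | e <- inc v2]]
  end.

Definition glue : trigraph := TriGraph glue_inc.

End Glue.

(* Gamma(g, n), for a choice of trees [T n] for Gamma(0, n) and of a leaf     *)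
(* edge [l n] in each.  There is no Gamma(g, 0); the value at n = 0 is        *)
(* Gamma(g, 1), the graph used to define P_(g,0).                             *)
Definition Gamma (T : nat -> trigraph) (l : forall n, edge (T n)) (g n : nat) :
    trigraph :=
  if g is h.+1 then
    if n <= 1 then chain h else glue (chain_leaf h) (l n.+1)
  else T n.

Section Blocks.
Variable G : trigraph.
Implicit Types (w : {ffun edge G -> nat}) (L K : nat).

(* [`|a - b|] is the distance [distn] of IntDist, not truncated subtraction.   *)
Definition admissible L (a b c : nat) : bool :=
  [&& a + b + c <= 2 * L, `|a - b| <= c <= a + b & ~~ odd (a + b + c)].

Definition admissible_at L w (v : vertex G) : bool :=
  admissible L (w (tnth (inc v) (inord 0)))
               (w (tnth (inc v) (inord 1)))
               (w (tnth (inc v) (inord 2))).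

(* [closed = true] imposes weight 0 on the leaf edges, as for n = 0. *)
Definition polytope (closed : bool) L w : bool :=
  [forall v, admissible_at L w v] &&
  (closed ==> [forall e, is_leaf e ==> (w e == 0)]).

Definition zero_wt : {ffun edge G -> nat} := [ffun=> 0].
Definition add_wt w1 w2 : {ffun edge G -> nat} := [ffun e => w1 e + w2 e].

Lemma polytope0 closed : polytope closed 0 zero_wt.
Proof.
apply/andP; split; last first.
  by apply/implyP=> _; apply/forallP=> e; rewrite ffunE eqxx implybT.
by apply/forallP=> v; rewrite /admissible_at !ffunE.
Qed.

Lemma admissibleD L K a b c a' b' c' :
  admissible L a b c -> admissible K a' b' c' ->
  admissible (L + K) (a + a') (b + b') (c + c').
Proof. by rewrite /admissible; lia. Qed.

Lemma polytopeD closed L K w1 w2 :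
  polytope closed L w1 -> polytope closed K w2 ->
  polytope closed (L + K) (add_wt w1 w2).
Proof.
move=> /andP[/forallP h1 z1] /andP[/forallP h2 z2]; apply/andP; split.
  by apply/forallP=> v; rewrite /admissible_at !ffunE; exact: admissibleD (h1 v) (h2 v).
case: closed z1 z2 => //= /forallP z1 /forallP z2; apply/forallP=> e.
apply/implyP=> le; rewrite ffunE.
by rewrite (eqP (implyP (z1 e) le)) (eqP (implyP (z2 e) le)).
Qed.

End Blocks.

(* The level is part of an element, so the zero weighting occurs once in each  *)
(* level.                                                                     *)
Record blocks (G : trigraph) (closed : bool) := Blocks {
  block_val : nat * {ffun edge G -> nat};
  _ : polytope closed block_val.1 block_val.2
}.

HB.instance Definition _ G closed := [isSub for @block_val G closed].
HB.instance Definition _ G closed := [Choice of blocks G closed by <:].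

Section Semigroup.
Variables (G : trigraph) (closed : bool).
Implicit Types x y z : blocks G closed.

Definition level x : nat := (val x).1.

Definition block_one : blocks G closed :=
  @Blocks G closed (0, zero_wt G) (polytope0 G closed).

Definition block_mul x y : blocks G closed :=
  @Blocks G closed ((val x).1 + (val y).1, add_wt (val x).2 (val y).2)
    (polytopeD (valP x) (valP y)).

Lemma block_mulA : associative block_mul.
Proof.
move=> x y z; apply: val_inj; congr pair; first exact: addnA.
by apply/ffunP=> e; rewrite !ffunE addnA.
Qed.

Lemma block_mulC : commutative block_mul.
Proof.
move=> x y; apply: val_inj; congr pair; first exact: addnC.
by apply/ffunP=> e; rewrite !ffunE addnC.
Qed.

Lemma block_mul1 : left_id block_one block_mul.
Proof.
move=> x; apply: val_inj; rewrite /=; case: (val x) => L w; congr pair.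
by apply/ffunP=> e; rewrite !ffunE.
Qed.

Lemma block_1mul : right_id block_one block_mul.
Proof. by move=> x; rewrite block_mulC block_mul1. Qed.

Lemma block_unit x y :
  block_mul x y = block_one -> x = block_one /\ y = block_one.
Proof.
move=> /(congr1 val)[/eqP eL /ffunP ew].
have H z : (val z).1 = 0 -> (forall e, (val z).2 e = 0) -> z = block_one.
  move=> zL zw; apply: val_inj; rewrite [val z]surjective_pairing zL.
  by congr pair; apply/ffunP=> e; rewrite zw ffunE.
move: eL; rewrite addn_eq0 => /andP[/eqP xL /eqP yL].
have xy e : (val x).2 e = 0 /\ (val y).2 e = 0.
  by have /eqP := ew e; rewrite !ffunE addn_eq0 => /andP[/eqP -> /eqP ->].
by split; apply: H => // e; case: (xy e).
Qed.

HB.instance Definition _ := Choice_isMonomialDef.Build (blocks G closed)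
  block_mulA block_mul1 block_1mul block_unit.
HB.instance Definition _ :=
  MonomialDef_isConomialDef.Build (blocks G closed) block_mulC.

End Semigroup.

Local Open Scope ring_scope.
Local Open Scope fset_scope.

Section Presentation.
Variables (C : comNzRingType) (G : trigraph) (closed : bool).

Definition semigroup_alg : comNzRingType := {malg C[blocks G closed]}.

Definition gen : choiceType :=
  {x : blocks G closed | (level x == 1%N) || (level x == 2%N)}.

Definition gen_poly : comNzRingType := {malg C[{cmonom gen}]}.

Definition mon_deg (m : {cmonom gen}) : nat :=
  (\sum_(x <- finsupp m) m x * level (val x))%N.

Definition homogeneous (d : nat) (p : gen_poly) : Prop :=
  forall m, m \in msupp p -> mon_deg m = d.

Definition mon_val (m : {cmonom gen}) : semigroup_alg :=
  \prod_(x <- finsupp m) (<< val x >> : {malg C[blocks G closed]}) ^+ m x.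

Definition natural_map (p : gen_poly) : semigroup_alg :=
  mmap (malgC : C -> {malg C[blocks G closed]}) mon_val p.

End Presentation.

Definition in_ideal_gen (A : comNzRingType) (X : A -> Prop) (p : A) : Prop :=
  exists s : seq (A * A),
    (forall q, q \in s -> X q.2) /\ p = \sum_(q <- s) q.1 * q.2.

(* Main.v *)
(* By degree 2 relations every monomial is equivalent to one whose factors are  *)
(* of level 2, except for at most one of level 1.  Such a monomial is a table   *)
(* of weightings, one row for each factor, and its value is given by the column *)
(* sums; replacing two rows by two rows with the same sum is a relation of      *)
(* degree at most 4.  So the kernel is generated in degrees <= 4 once any two   *)
(* tables with the same row levels and column sums are connected by such moves. *)
(* Along the chain of loops all links have weight 0 or 2 in level at most 2, so *)
(* there are few possibilities for each pair of parallel edges, and two tables  *)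
(* can be made to agree from left to right.  On the tree, a level 2 row is the  *)
(* sum of two level 1 rows with equal values at the root, and level 1 rows are  *)
(* connected by exchanging subtrees below edges of equal weight.  Generation in *)
(* levels 1 and 2 follows by subtracting a level 2 row from any row of level at *)
(* least 3, the links of the former having weight 2 wherever those of the       *)
(* latter are not 0.                                                            *)

From HB Require Import structures.
Require Import Defs.
From mathcomp Require Import all_boot all_order all_algebra finmap.
From mathcomp Require Import zify.
From mathcomp Require Import reals complex.
From mathcomp.multinomials Require Import monalg.

Set Implicit Arguments.
Unset Strict Implicit.
Unset Printing Implicit Defensive.

Import GRing.Theory IntDist.

(** * Tables of weightings and pair moves *)

(** A monomial in the generators is a finite table whose rows are weightings of level 1 or 2, and
    its value in the semigroup algebra remembers only the total level and the column sums.
    Generation and relations thus become combinatorial statements, collected in the record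
    [decomposable]: a weighting of level at least 3 has a summand of level 2 with valid complement,
    and two tables with the same row levels and column sums are linked by moves that redistribute
    two rows. [Gamma_decomposable] proves them for all the graphs; [seq_val_surj] and
    [kernel_presentation] translate them into algebra.

    On a binary tree, a weighting of level L+1 splits into one of level 1 and one of level L, with a
    prescribed splitting of the root value ([admissible_split], [tree_split]). Rows of level 2 can
    therefore be cut into halves of level at most 1. There all weights are 0 or 1, and the weights
    on the two edges below a node can be matched by exchanging whole subtrees ([node_balance],
    [tree_conn]). This settles genus 0 ([rooted_tree_conn]).

    In positive genus the graph is a sequence of blobs, each a loop or a pair of parallel edges with
    an outgoing link, followed by a tree. Parity makes all links even, so in level at most 2 they
    are 0 or 2 and [blobE] leaves few cases. Two tables are matched blob by blob: first the outgoing
    links ([balance_out]), then the sums of the parallel weights ([balance_sum]), then these weights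
    themselves ([balance_para]). The tree is reached with a fixed even root value, which can be
    halved ([tree_agree]). Summands of level 2 are built in the same order ([blob_split],
    [chain_peel]).

    [tree_btree] turns a trivalent tree into a binary tree rooted at a leaf. The case n = 0 follows
    from the graph with one leaf, because a zero leaf weight passes to all summands
    ([polytope_summand]). *)

Section Tables.
Variables (I E : finType) (V : I -> {ffun E -> nat} -> bool).
Implicit Types (T : {ffun I -> {ffun E -> nat}}) (k m i : I) (e : E).

Definition valid T := forall k, V k (T k).

Definition move T T' :=
  exists k m, [/\ k != m, forall i, i != k -> i != m -> T' i = T i
    & forall e, T' k e + T' m e = T k e + T m e].

(** Validity is demanded after each move, so that every intermediate table is again a product of
    generators. *)
Inductive conn T T' : Prop :=
  | conn_refl of T = T'
  | conn_step T1 of move T T1 & valid T1 & conn T1 T'.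

Definition same_sums T T' := forall e, \sum_i T i e = \sum_i T' i e.

Lemma move_sums T T' : move T T' -> same_sums T T'.
Proof.
move=> [k [m [km off on]]] e.
rewrite (bigD1 k) //= (bigD1 m) /=; last by rewrite eq_sym.
rewrite [RHS](bigD1 k) //= [in RHS](bigD1 m) /=; last by rewrite eq_sym.
rewrite !addnA on; congr (_ + _); apply: eq_bigr => i /andP[ik im].
by rewrite off.
Qed.

Lemma conn_sums T T' : conn T T' -> same_sums T T'.
Proof.
elim=> [? ? -> //|T0 T'0 T1 mv _ _ IH] e.
by rewrite (move_sums mv) IH.
Qed.

Lemma conn_trans T1 T2 T3 : conn T1 T2 -> conn T2 T3 -> conn T1 T3.
Proof.
elim=> [? ? -> //|T0 T'0 T4 mv v4 _ IH] /IH; exact: conn_step.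
Qed.

Lemma conn_sym T T' : valid T -> conn T T' -> conn T' T.
Proof.
move=> vT c; elim: c vT => [T0 T0' ->|T0 T0' T1 mv v1 _ IH] vT; first exact: conn_refl.
apply: conn_trans (IH v1) _; apply: (@conn_step _ _ T0) => //; last exact: conn_refl.
case: mv => k [m [km off on]]; exists k, m; split=> // i ik im.
by rewrite off.
Qed.

Definition replace2 k m a b T : {ffun I -> {ffun E -> nat}} :=
  [ffun i => if i == k then a else if i == m then b else T i].

Lemma replace2l k m a b T : replace2 k m a b T k = a.
Proof. by rewrite ffunE eqxx. Qed.

Lemma replace2r k m a b T : k != m -> replace2 k m a b T m = b.
Proof. by rewrite ffunE eq_sym => /negPf ->; rewrite eqxx. Qed.

Lemma replace2_off k m a b T i : i != k -> i != m -> replace2 k m a b T i = T i.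
Proof. by rewrite ffunE => /negPf -> /negPf ->. Qed.

Lemma replace2_conn k m a b T : valid T -> k != m -> V k a -> V m b ->
    (forall e, a e + b e = T k e + T m e) ->
  valid (replace2 k m a b T) /\ conn T (replace2 k m a b T).
Proof.
move=> vT km va vb sum.
have v1 : valid (replace2 k m a b T).
  by move=> i; rewrite ffunE; case: eqP => [->//|_]; case: eqP => [->|].
split=> //; apply: (conn_step _ v1); last exact: conn_refl.
exists k, m; split=> // [i ik im|e]; first by rewrite replace2_off.
by rewrite replace2l replace2r.
Qed.

Definition pick_on (R : pred E) (a b : {ffun E -> nat}) : {ffun E -> nat} :=
  [ffun e => if R e then a e else b e].

Definition swap_on (R : pred E) k m T :=
  replace2 k m (pick_on R (T m) (T k)) (pick_on R (T k) (T m)) T.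

Lemma swap_conn (R : pred E) k m T : valid T -> k != m ->
    V k (pick_on R (T m) (T k)) -> V m (pick_on R (T k) (T m)) ->
  valid (swap_on R k m T) /\ conn T (swap_on R k m T).
Proof.
move=> vT km vk vm; apply: replace2_conn => // e; rewrite !ffunE.
by case: ifP; rewrite // addnC.
Qed.

Lemma swap_onE (R : pred E) k m T e : R e -> k != m ->
  [/\ swap_on R k m T k e = T m e, swap_on R k m T m e = T k e
   & forall i, i != k -> i != m -> swap_on R k m T i = T i].
Proof.
move=> Re km; rewrite /swap_on replace2l replace2r // !ffunE Re; split=> // i ik im.
by rewrite replace2_off.
Qed.

Lemma swap_on_off (R : pred E) k m T i e : ~~ R e -> swap_on R k m T i e = T i e.
Proof.
move=> /negPf Re; rewrite /swap_on !ffunE.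
by case: eqP => [->|_]; [|case: eqP => [->|//]]; rewrite ffunE Re.
Qed.

(** The common pattern for matching a row statistic [f] of two tables. As the totals agree, a row
    [k] where the target has more comes with a row [m] where it has less. A step that narrows the
    gap at [k] without overshooting at [m] lowers the sum of the truncated differences
    [f T' i - f T i], the induction measure. Both tables may change, which [balance_out]
    exploits. *)
Lemma balance2 (Q : {ffun I -> {ffun E -> nat}} -> {ffun I -> {ffun E -> nat}} -> Prop)
    (f : {ffun I -> {ffun E -> nat}} -> I -> nat) :
    (forall T T', Q T T' -> \sum_i f T i = \sum_i f T' i) ->
    (forall T T' k m, Q T T' -> f T k < f T' k -> f T' m < f T m ->
      exists T1 T1', [/\ Q T1 T1', conn T T1, conn T' T1',
        f T1' k - f T1 k < f T' k - f T k /\ f T1' m <= f T1 m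
      & forall i, i != k -> i != m -> f T1 i = f T i /\ f T1' i = f T' i]) ->
  forall T T', Q T T' ->
  exists T1 T1', [/\ Q T1 T1', conn T T1, conn T' T1' & f T1 =1 f T1'].
Proof.
move=> fsum step T T'; have [n] := ubnP (\sum_i (f T' i - f T i)).
elim: n T T' => // n IH T T' len q.
have [/forallP le|/forallPn[k]] := boolP [forall i, f T' i <= f T i].
  exists T, T'; split=> //; try exact: conn_refl.
  move=> i; apply/eqP; rewrite eqn_leq le andbT leqNgt; apply/negP => lt.
  have := fsum _ _ q; rewrite (bigD1 i) //= [in RHS](bigD1 i) //=.
  have : \sum_(j | j != i) f T' j <= \sum_(j | j != i) f T j by apply: leq_sum => j _.
  by lia.
rewrite -ltnNge => ltk.
have [/forallP ge|/forallPn[m]] := boolP [forall i, f T i <= f T' i].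
  have := fsum _ _ q; rewrite (bigD1 k) //= [in RHS](bigD1 k) //=.
  have : \sum_(j | j != k) f T j <= \sum_(j | j != k) f T' j by apply: leq_sum => j _.
  by lia.
rewrite -ltnNge => ltm.
have [T1 [T1' [q1 c1 c1' [dk dm] off]]] := step _ _ _ _ q ltk ltm.
have mk : m != k by apply/eqP => mk; subst m; lia.
have [|T2 [T2' [q2 c2 c2' e2]]] := IH T1 T1' _ q1; last first.
  by exists T2, T2'; split=> //; [exact: conn_trans c1 c2|exact: conn_trans c1' c2'].
rewrite ltnS in len; apply: leq_trans len.
rewrite (bigD1 k) //= (bigD1 m) //= [leqRHS](bigD1 k) //= [in leqRHS](bigD1 m) //=.
rewrite (eq_bigr (fun i => f T' i - f T i)) => [|i /andP[ik im]]; last first.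
  by case: (off i ik im) => -> ->.
by lia.
Qed.

End Tables.

(** * Joining half rows into rows *)

Section Lift.
Variables (I E : finType) (V : I -> {ffun E -> nat} -> bool).
Variable Vh : I * bool -> {ffun E -> nat} -> bool.
Variables (B : {ffun I -> {ffun E -> nat}}) (S : pred E).

Definition join_halves (H : {ffun I * bool -> {ffun E -> nat}}) : {ffun I -> {ffun E -> nat}} :=
  [ffun k => [ffun e => if S e then H (k, false) e + H (k, true) e else B k e]].

(* A move of half rows is a move of rows, or changes nothing when the two halves *)
(* belong to the same row. *)
Lemma join_halves_conn H H' : (forall H, valid Vh H -> valid V (join_halves H)) ->
  conn Vh H H' -> conn V (join_halves H) (join_halves H').
Proof.
move=> vm; elim=> [? ? ->|H0 H0' H1 [[k b] [[m c] [km off on]]] v1 _ IH].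
  exact: conn_refl.
have [ekm|nkm] := eqVneq k m.
  suff -> : join_halves H0 = join_halves H1 by [].
  subst m; have cb : c = ~~ b by case: b c km {off on} => [] [] //; rewrite eqxx.
  apply/ffunP => i; apply/ffunP => e; rewrite !ffunE; case: ifP => // _.
  have [->|ik] := eqVneq i k.
    by have := on e; subst c; case: b {off on km} => /=; lia.
  by rewrite !off // xpair_eqE (negPf ik).
apply: (conn_step _ (vm _ v1) IH).
exists k, m; split=> // [i ik im|e].
  by apply/ffunP => e; rewrite !ffunE !off // xpair_eqE ?(negPf ik) ?(negPf im).
rewrite !ffunE; case: ifP => // _; have := on e.
have nk : H1 (k, ~~ b) = H0 (k, ~~ b).
  by apply: off; rewrite xpair_eqE ?(negPf nkm) ?eqxx //; case: (b).
have nm : H1 (m, ~~ c) = H0 (m, ~~ c).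
  by apply: off; rewrite xpair_eqE 1?eq_sym ?(negPf nkm) ?eqxx //; case: (c).
by move: nk nm; case: b c {km off on} => [] [] /= -> ->; lia.
Qed.

End Lift.

(** * Binary trees *)

(* The edge above the root is not part of the tree; its weight is the argument *)
(* [p] of [tree_wt]. *)
Inductive btree (A E : Type) :=
  Tip | Node of A & E & E & btree A E & btree A E.
Arguments Tip {A E}.

Section TreeWeights.
Variables (A : Type) (E : finType).
Implicit Types (t : btree A E) (w : {ffun E -> nat}) (L p : nat).

Fixpoint tree_edges t : seq E :=
  if t is Node _ a b ta tb then a :: b :: tree_edges ta ++ tree_edges tb
  else [::].

Fixpoint tree_wt t L p w : bool :=
  if t is Node _ a b ta tb then
    [&& admissible L p (w a) (w b), tree_wt ta L (w a) w & tree_wt tb L (w b) w]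
  else p <= L.

Lemma tree_wt_eq t L p w w' : {in tree_edges t, w =1 w'} ->
  tree_wt t L p w = tree_wt t L p w'.
Proof.
elim: t p => //= v a b ta IHa tb IHb p ew.
rewrite !ew ?inE ?eqxx ?orbT // IHa ?IHb // => e et; apply: ew;
by rewrite !inE mem_cat et !orbT.
Qed.

Lemma tree_wt_le t L p w : tree_wt t L p w -> p <= L.
Proof. by case: t => //= v a b ta tb /and3P[]; rewrite /admissible; lia. Qed.

Lemma tree_wt0 t p w : tree_wt t 0 p w -> p = 0 /\ {in tree_edges t, forall e, w e = 0}.
Proof.
elim: t p => [p /=|v a b ta IHa tb IHb p /= /and3P[adm /IHa[wa za] /IHb[wb zb]]].
  by rewrite leqn0 => /eqP.
split; first by move: adm; rewrite /admissible; lia.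
by move=> e; rewrite !inE mem_cat => /or4P[/eqP->|/eqP->|/za|/zb].
Qed.

(* Admissible triples of level L are sums of L triples among 000, 110, 101, 011. *)
Lemma admissible_split L x y z x1 x2 : admissible L.+1 x y z ->
    x = x1 + x2 -> x1 <= 1 -> x2 <= L ->
  exists y1 z1, [/\ admissible 1 x1 y1 z1, y1 <= y, z1 <= z
    & admissible L x2 (y - y1) (z - z1)].
Proof.
move=> adm ex x1le x2le.
have [x10|x10] := posnP x1.
  have [yz|yz] := boolP [&& 0 < y, 0 < z & x < y + z].
    by exists 1, 1; move: adm; rewrite /admissible; split; lia.
  by exists 0, 0; move: adm; rewrite /admissible; split; lia.
have [yz|yz] := boolP ((0 < y) && (z < x + y)).
  by exists 1, 0; move: adm; rewrite /admissible; split; lia.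
by exists 0, 1; move: adm; rewrite /admissible; split; lia.
Qed.

Lemma admissible_le L p y z : admissible L p y z -> [/\ p <= L, y <= L & z <= L].
Proof. by rewrite /admissible => adm; split; lia. Qed.

(** The possible triples are 000, 110, 101 and 011; the correction term accounts for the last
    one. *)
Lemma admissible_le1 L p y z : L <= 1 -> admissible L p y z ->
  [/\ p <= L, y <= L & y + z = p + 2 * ((p == 0) * y)].
Proof. by rewrite /admissible; case: eqP => p0 Lle adm; split; lia. Qed.

(** The splitting proceeds downwards: the one prescribed above a node gives, by [admissible_split],
    a splitting of the weights on the two edges below it, which is prescribed in turn for the
    subtrees. *)
Lemma tree_split t L p w p1 p2 : uniq (tree_edges t) -> tree_wt t L.+1 p w ->
    p = p1 + p2 -> p1 <= 1 -> p2 <= L ->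
  exists h1 h2, [/\ tree_wt t 1 p1 h1, tree_wt t L p2 h2
    & {in tree_edges t, forall e, w e = h1 e + h2 e}].
Proof.
elim: t p p1 p2 => [|v a b ta IHa tb IHb] p p1 p2 /=.
  by move=> _ _ _ p1le p2le; exists [ffun=> 0], [ffun=> 0]; split.
rewrite inE !mem_cat !negb_or cat_uniq => /andP[/and3P[nab naa nab']].
case/andP=> /andP[nba nbb] /and3P[ua dis ub] /and3P[adm wa wb] ep p1le p2le.
have [a1 [b1 [adm1 a1le b1le adm2]]] := admissible_split adm ep p1le p2le.
have [_ a1le1 b1le1] := admissible_le adm1.
have [_ a2le b2le] := admissible_le adm2.
have [ha1 [ha2 [va1 va2 ea]]] := IHa _ a1 (w a - a1) ua wa (esym (subnKC a1le)) a1le1 a2le.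
have [hb1 [hb2 [vb1 vb2 eb]]] := IHb _ b1 (w b - b1) ub wb (esym (subnKC b1le)) b1le1 b2le.
pose h x y ha hb : {ffun E -> nat} := [ffun e => if e == a then x else
  if e == b then y else if e \in tree_edges ta then ha e else hb e].
have hE x y ha hb : [/\ h x y ha hb a = x, h x y ha hb b = y,
    {in tree_edges ta, h x y ha hb =1 ha} & {in tree_edges tb, h x y ha hb =1 hb}].
  split=> [||e et|e et]; rewrite ffunE ?eqxx //.
  - by rewrite eq_sym (negPf nab).
  - have [ea0|_] := eqVneq e a; first by rewrite -ea0 et in naa.
    by have [eb0|_] := eqVneq e b; [rewrite -eb0 et in nba|rewrite et].
  - have [ea0|_] := eqVneq e a; first by rewrite -ea0 et in nab'.
    have [eb0|_] := eqVneq e b; first by rewrite -eb0 et in nbb.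
    by case: ifP => // eta; case/hasP: dis; exists e.
have [h1a h1b h1ta h1tb] := hE a1 b1 ha1 hb1.
have [h2a h2b h2ta h2tb] := hE (w a - a1) (w b - b1) ha2 hb2.
exists (h a1 b1 ha1 hb1), (h (w a - a1) (w b - b1) ha2 hb2).
split; rewrite ?h1a ?h1b ?h2a ?h2b.
- by rewrite adm1 (tree_wt_eq _ _ h1ta) va1 (tree_wt_eq _ _ h1tb).
- by rewrite adm2 (tree_wt_eq _ _ h2ta) va2 (tree_wt_eq _ _ h2tb).
- move=> e; rewrite !inE mem_cat => /or4P[/eqP->|/eqP->|et|et].
  + by rewrite h1a h2a subnKC.
  + by rewrite h1b h2b subnKC.
  + by rewrite h1ta // h2ta // ea.
  + by rewrite h1tb // h2tb // eb.
Qed.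

End TreeWeights.

(** * Connecting tables supported on a tree *)

Section Fragments.
Variables (I E : finType) (V : I -> {ffun E -> nat} -> bool) (l : I -> nat).
Implicit Types (T : {ffun I -> {ffun E -> nat}}) (k m i : I) (e : E).
Implicit Types (S : seq E) (w : {ffun E -> nat}).

(* The weights of row [k] on the edges of [S] may be changed freely, as long as *)
(* [ok] holds for the level and the value [P k] of the edge leading into [S].   *)
Record fragment S (P : I -> {ffun E -> nat} -> nat)
    (ok : nat -> nat -> {ffun E -> nat} -> bool) : Prop := Fragment {
  fragment_local : forall L p w w', {in S, w =1 w'} -> ok L p w = ok L p w';
  fragment_ok : forall k w, V k w -> ok (l k) (P k w) w;
  fragment_inv : forall k w w', (forall e, e \notin S -> w' e = w e) ->
    P k w' = P k w;
  fragment_replace : forall k w w', V k w -> (forall e, e \notin S -> w' e = w e) ->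
    ok (l k) (P k w) w' -> V k w'
}.

Definition related S T T' := [/\ valid V T, valid V T',
  forall k e, e \notin S -> T k e = T' k e & same_sums T T'].

Lemma related_sub S S' T T' : {subset S' <= S} ->
    related S T T' -> (forall k e, e \in S -> e \notin S' -> T k e = T' k e) ->
  related S' T T'.
Proof.
move=> sub [vT vT' off sums] more; split=> // k e eS'.
by have [eS|eS] := boolP (e \in S); [exact: more|exact: off].
Qed.

Lemma related_inv S P ok T T' k : fragment S P ok -> related S T T' ->
  P k (T k) = P k (T' k).
Proof. by move=> fr [_ _ off _]; rewrite (fragment_inv fr k (off k)). Qed.

Lemma related_eq T T' : related [::] T T' -> T = T'.
Proof. by case=> _ _ off _; apply/ffunP => k; apply/ffunP => e; exact: off. Qed.

Lemma fragment_swap S P ok T k m : fragment S P ok -> valid V T ->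
  l k = l m -> P k (T k) = P m (T m) -> V k (pick_on (mem S) (T m) (T k)).
Proof.
move=> fr vT lkm Pkm; apply: (fragment_replace fr (vT k)).
  by move=> e eS; rewrite ffunE /= (negPf eS).
rewrite (@fragment_local _ _ _ fr _ _ _ (T m)); last first.
  by move=> e eS; rewrite ffunE /= eS.
by rewrite lkm Pkm; exact: (fragment_ok fr).
Qed.

Lemma related_conn S T T1 T' : related S T T' ->
    valid V T1 -> conn V T T1 -> (forall k e, e \notin S -> T1 k e = T k e) ->
  related S T1 T'.
Proof.
move=> [vT vT' off sums] v1 c1 off1; split=> // [k e eS|e].
  by rewrite off1 // off.
by rewrite -sums (conn_sums c1).
Qed.

Lemma related_sym S T T' : related S T T' -> related S T' T.
Proof. by move=> [vT vT' off sums]; split=> // k e eS; rewrite off. Qed.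

Lemma related_swap S S' P ok T T' k m : fragment S' P ok -> {subset S' <= S} ->
    related S T T' -> k != m ->
    l k = l m -> P k (T k) = P m (T m) ->
  related S (swap_on (mem S') k m T) T' /\ conn V T (swap_on (mem S') k m T).
Proof.
move=> fr sub rel km lkm Pkm; have [vT _ _ _] := rel.
have [v1 c1] := swap_conn vT km (fragment_swap fr vT lkm Pkm)
  (fragment_swap fr vT (esym lkm) (esym Pkm)).
split=> //; apply: (related_conn rel v1 c1) => i e eS.
by apply: swap_on_off; apply: contra eS => /sub.
Qed.

Lemma fragment_sub S S' P P' ok (ok' : nat -> nat -> {ffun E -> nat} -> bool) :
    fragment S P ok -> {subset S' <= S} ->
    (forall L p w w', {in S', w =1 w'} -> ok' L p w = ok' L p w') ->
    (forall k w, ok (l k) (P k w) w -> ok' (l k) (P' k w) w) ->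
    (forall k w w', (forall e, e \notin S' -> w' e = w e) -> P' k w' = P' k w) ->
    (forall k w w', ok (l k) (P k w) w -> (forall e, e \notin S' -> w' e = w e) ->
      ok' (l k) (P' k w) w' -> ok (l k) (P k w) w') ->
  fragment S' P' ok'.
Proof.
move=> fr sub loc okP inv rep; split=> // k w; first by move/(fragment_ok fr)/okP.
move=> w' vw off wt; apply: (fragment_replace fr vw).
  by move=> e eS; apply: off; apply: contra eS => /sub.
by apply: (rep _ _ _ _ off wt); exact: (fragment_ok fr).
Qed.

Section Trees.
Variable A : Type.
Implicit Types (t ta tb : btree A E) (v : A).

Lemma fragment_left v a b ta tb P :
    uniq (tree_edges (Node v a b ta tb)) ->
    fragment (tree_edges (Node v a b ta tb)) P (tree_wt (Node v a b ta tb)) ->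
  fragment (tree_edges ta) (fun _ w => w a) (tree_wt ta).
Proof.
rewrite [uniq _]/= inE !mem_cat !negb_or => /andP[/and3P[nab naa nab']].
rewrite cat_uniq => /andP[/andP[nba nbb] /and3P[ua dis ub]] fr.
apply: (fragment_sub fr) => [e et|L p w w' ew|k w /and3P[] //||].
- by rewrite /= !inE mem_cat et !orbT.
- exact: tree_wt_eq.
- by move=> k w w' off; exact: off.
- move=> k w w' /and3P[adm _ vb] off wt; rewrite /= !off // adm wt /=.
  rewrite -(@tree_wt_eq _ _ _ _ _ w) // => e et; rewrite off //.
  by apply: contra dis => eta; apply/hasP; exists e.
Qed.

Lemma fragment_right v a b ta tb P :
    uniq (tree_edges (Node v a b ta tb)) ->
    fragment (tree_edges (Node v a b ta tb)) P (tree_wt (Node v a b ta tb)) ->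
  fragment (tree_edges tb) (fun _ w => w b) (tree_wt tb).
Proof.
rewrite [uniq _]/= inE !mem_cat !negb_or => /andP[/and3P[nab naa nab']].
rewrite cat_uniq => /andP[/andP[nba nbb] /and3P[ua dis ub]] fr.
apply: (fragment_sub fr) => [e et|L p w w' ew|k w /and3P[] //||].
- by rewrite /= !inE mem_cat et !orbT.
- exact: tree_wt_eq.
- by move=> k w w' off; exact: off.
- move=> k w w' /and3P[adm va _] off wt; rewrite /= !off // adm wt /= andbT.
  rewrite -(@tree_wt_eq _ _ _ _ _ w) // => e et; rewrite off //.
  by apply: contra dis => etb; apply/hasP; exists e.
Qed.

(** Rows of equal level and equal root value can exchange everything below the root. Such exchanges
    first match the rows of type 011 and then the position of the single 1 in the rows of root value
    1. *)
Lemma node_balance v a b ta tb P T T' : (forall k, l k <= 1) ->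
    uniq (tree_edges (Node v a b ta tb)) ->
    let t := Node v a b ta tb in
    fragment (tree_edges t) P (tree_wt t) -> related (tree_edges t) T T' ->
  exists T1, [/\ conn V T T1, related (tree_edges t) T1 T' &
    forall k, T1 k a = T' k a /\ T1 k b = T' k b].
Proof.
move=> l1 ut t fr rel; set S := tree_edges t in fr rel *.
have aS : a \in S by rewrite inE eqxx.
have bS : b \in S by rewrite !inE eqxx orbT.
(* As [a + b = P + 2 f], the column sums determine the sum of [f]. *)
pose f T k := (P k (T k) == 0) * T k a.
have adm T0 k : valid V T0 -> [/\ P k (T0 k) <= l k, T0 k a <= l k
    & T0 k a + T0 k b = P k (T0 k) + 2 * f T0 k].
  by move=> v0; have /and3P[/(admissible_le1 (l1 k))] := fragment_ok fr (v0 k).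
have fE T0 k (v0 : valid V T0) : T0 k a + T0 k b = P k (T0 k) + (f T0 k + f T0 k).
  by case: (adm T0 k v0); rewrite addnn -mul2n.
have swapP T0 T0' k m : related S T0 T0' -> k != m -> l k = l m ->
    P k (T0 k) = P m (T0 m) ->
    let T1 := swap_on (mem S) k m T0 in
    [/\ related S T1 T0', conn V T0 T1, T1 k a = T0 m a, T1 m a = T0 k a
      & (forall i, i != k -> i != m -> T1 i = T0 i) /\ forall i, P i (T1 i) = P i (T0 i)].
  move=> rel0 km lkm Pkm T1.
  have [rel1 c1] := related_swap fr (fun e He => He) rel0 km lkm Pkm.
  have [k1 m1 off1] := @swap_onE _ _ (mem S) k m T0 _ aS km; split=> //; split=> // i.
  by rewrite (related_inv i fr rel1) (related_inv i fr rel0).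
have [T1 [T1' [rel1 c1 c1' e1]]] : exists T1 T1', [/\ related S T1 T', conn V T T1,
    T1' = T' & f T1 =1 f T1'].
  have [||T1 [T1' [[rel1 e1] c1 _ fe]]] := @balance2 _ _ V
      (fun T0 T0' => related S T0 T0' /\ T0' = T') f _ _ T T' (conj rel erefl).
  - move=> T0 T0' [rel0 _]; have [v0 v0' _ sums] := rel0.
    have : \sum_k (T0 k a + T0 k b) = \sum_k (T0' k a + T0' k b).
      by rewrite !big_split /= !sums.
    rewrite (eq_bigr (fun k => P k (T0 k) + (f T0 k + f T0 k))) => [|k _]; last exact: fE.
    rewrite [RHS](eq_bigr (fun k => P k (T0 k) + (f T0' k + f T0' k))) => [|k _]; last first.
      by rewrite fE // (related_inv k fr rel0).
    by rewrite !big_split /=; lia.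
  (* Rows where [f] differs have root value 0, and a weight 1 at [a] in one of the tables forces
     level 1 on both rows; so the two rows can be exchanged below the root. *)
  - move=> T0 T0' k m [rel0 e0] ltk ltm; have [v0 v0' _ _] := rel0.
    have km : k != m by apply/eqP => km; subst m; lia.
    have Pk := related_inv k fr rel0; have Pm := related_inv m fr rel0.
    have [Pkl ak _] := adm _ k v0; have [_ ak' _] := adm _ k v0'.
    have [Pml am _] := adm _ m v0; have [_ am' _] := adm _ m v0'.
    have lk := l1 k; have lm := l1 m.
    move: ltk ltm; rewrite /f -Pk -Pm.
    have [Pk0|_] := eqVneq (P k (T0 k)) 0; last by rewrite !mul0n ltnn.
    have [Pm0|_] := eqVneq (P m (T0 m)) 0; last by rewrite !mul0n ltnn.
    rewrite !mul1n => ltk ltm.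
    have [||rel2 c2 k2 m2 [off2 P2]] := swapP _ _ k m rel0 km.
    + lia.
    + by rewrite Pm0.
    exists (swap_on (mem S) k m T0), T0'; split=> //; first exact: conn_refl.
      rewrite !P2 k2 m2 Pk0 Pm0 !eqxx.
      lia.
    by move=> i ik im; rewrite off2.
  by exists T1, T1'; rewrite -e1; subst T1'.
subst T1'.
have [||T2 [T2' [[rel2 e2 e2'] c2 _ ae]]] := @balance2 _ _ V
    (fun T0 T0' => [/\ related S T0 T0', T0' = T' & f T0 =1 f T0'])
    (fun T k => T k a) _ _ T1 T' (And3 rel1 erefl e1).
- by move=> T0 T0' [[_ _ _ sums] _ _]; exact: sums.
(* Now rows of root value 0 agree at [a]. Rows that differ there have root value 1, hence level 1,
   and are exchanged. *)
- move=> T0 T0' k m [rel0 e0 fe] ltk ltm; have [v0 v0' _ _] := rel0.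
  have km : k != m by apply/eqP => km; subst m; lia.
  have Pk := related_inv k fr rel0; have Pm := related_inv m fr rel0.
  have [Pkl ak _] := adm _ k v0; have [_ ak' _] := adm _ k v0'.
  have [Pml am _] := adm _ m v0; have [_ am' _] := adm _ m v0'.
  have lk := l1 k; have lm := l1 m.
  have := fe k; have := fe m; rewrite /f -Pk -Pm.
  have [Pm0|Pm0] := eqVneq (P m (T0 m)) 0; first by lia.
  have [Pk0|Pk0] := eqVneq (P k (T0 k)) 0; first by lia.
  move=> _ _.
  have [||rel2 c2 k2 m2 [off2 P2]] := swapP _ _ k m rel0 km.
  + lia.
  + lia.
  have fe2 : f (swap_on (mem S) k m T0) =1 f T0'.
    move=> i; rewrite -fe /f P2; have [->|ik] := eqVneq i k; first by rewrite (negPf Pk0).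
    by have [->|im] := eqVneq i m; [rewrite (negPf Pm0)|rewrite off2].
  exists (swap_on (mem S) k m T0), T0'; split=> //; first exact: conn_refl.
    by rewrite k2 m2; lia.
  by move=> i ik im; rewrite off2.
subst T2'; exists T2; split=> // [|k]; first exact: conn_trans c1 c2.
split; first exact: ae.
have [v2 v2' _ _] := rel2; have := fE _ k v2; have := fE _ k v2'.
by rewrite -(related_inv k fr rel2) -(e2' k) (ae k); lia.
Qed.

Lemma tree_conn t P T T' : (forall k, l k <= 1) -> uniq (tree_edges t) ->
  fragment (tree_edges t) P (tree_wt t) -> related (tree_edges t) T T' -> conn V T T'.
Proof.
move=> l1; elim: t P T T' => [|v a b ta IHa tb IHb] P T T' ut fr rel.
  by apply: conn_refl; exact: related_eq.
have [T1 [c1 rel1 ab]] := node_balance l1 ut fr rel.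
apply: (conn_trans c1).
have frl := fragment_left ut fr; have frr := fragment_right ut fr.
have [v1 v' off sums] := rel1.
(* [T2] is the target on the left subtree and [T1] elsewhere; it is valid because the two agree at
   [a]. The induction hypotheses connect [T1] to [T2] and [T2] to [T']. *)
pose T2 : {ffun I -> {ffun E -> nat}} :=
  [ffun k => pick_on (mem (tree_edges ta)) (T' k) (T1 k)].
have offa k e : e \notin tree_edges ta -> T2 k e = T1 k e.
  by move=> et; rewrite !ffunE /= (negPf et).
have ona k e : e \in tree_edges ta -> T2 k e = T' k e.
  by move=> et; rewrite !ffunE /= et.
have ut' : [/\ uniq (tree_edges ta), uniq (tree_edges tb) &
    forall e, e \in tree_edges ta -> e \notin tree_edges tb].
  move: ut; rewrite /= cat_uniq => /and3P[_ _ /and3P[ua dis ub]]; split=> // e eta.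
  by apply: contra dis => etb; apply/hasP; exists e.
have [ua ub dis] := ut'.
have v2 : valid V T2.
  move=> k; apply: (fragment_replace frl (v1 k) (offa k)).
  rewrite (fragment_local frl _ _ (ona k)) (proj1 (ab k)).
  exact: (fragment_ok frl (v' k)).
have sums2 : same_sums T1 T2.
  move=> e; have [et|et] := boolP (e \in tree_edges ta).
    by rewrite sums; apply: eq_bigr => k _; rewrite ona.
  by apply: eq_bigr => k _; rewrite offa.
have rel12 : related (tree_edges ta) T1 T2 by split=> // k e et; rewrite offa.
apply: conn_trans (IHa _ _ _ ua frl rel12) _.
apply: (IHb _ _ _ ub frr); split=> // [k e et|e]; last by rewrite -sums2 sums.
have [eta|eta] := boolP (e \in tree_edges ta); first exact: ona.
rewrite offa //; have [->|ea] := eqVneq e a; first by case: (ab k).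
have [->|eb] := eqVneq e b; first by case: (ab k).
by apply: off; rewrite /= !inE mem_cat (negPf ea) (negPf eb) (negPf eta) (negPf et).
Qed.

End Trees.
End Fragments.

(** * Reduction of rows of level 2 to half rows of level at most 1 *)

Section Halves.
Variables (I E : finType) (V : I -> {ffun E -> nat} -> bool).
Variables (Vh : I * bool -> {ffun E -> nat} -> bool) (S : seq E).
Variable B : {ffun I -> {ffun E -> nat}}.

(** Cut every row into two half rows, set to 0 off [S]. The two half tables then have equal column
    sums, and a connection between them joins back to a connection of the original tables. *)
Lemma halves_conn T T' :
    (forall H, valid Vh H -> valid V (join_halves B (mem S) H)) ->
    (forall k w, V k w -> (forall e, e \notin S -> w e = B k e) ->
      exists2 h : bool -> {ffun E -> nat},
      forall b, Vh (k, b) (h b) & forall e, e \in S -> w e = h false e + h true e) ->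
    (forall j (w w' : {ffun E -> nat}), {in S, w =1 w'} -> Vh j w -> Vh j w') ->
    (forall H H', related Vh S H H' -> conn Vh H H') ->
    related V S B T -> related V S B T' -> conn V T T'.
Proof.
move=> vm split loc hc relT relT'.
have ex T0 : related V S B T0 -> exists H, [/\ valid Vh H, join_halves B (mem S) H = T0
    & forall j e, e \notin S -> H j e = 0].
  move=> [_ v0 off0 _].
  have /fin_all_exists[h hP] k : exists h : bool -> {ffun E -> nat},
      (forall b, Vh (k, b) (h b)) /\ forall e, e \in S -> T0 k e = h false e + h true e.
    have offk e : e \notin S -> T0 k e = B k e by move=> eS; rewrite off0.
    by have [h h1 h2] := split _ _ (v0 k) offk; exists h.
  exists [ffun j => [ffun e => if e \in S then h j.1 j.2 e else 0]]; split.
  - move=> [k b]; rewrite ffunE; apply: loc (proj1 (hP k) b) => e eS.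
    by rewrite ffunE eS.
  - apply/ffunP => k; apply/ffunP => e; rewrite !ffunE /=; case: ifP => eS.
      by rewrite (_ : e \in S) // -(proj2 (hP k)).
    by apply: off0; exact: negbT eS.
  - by move=> j e /negPf eS; rewrite !ffunE eS.
have [H [vH mH zH]] := ex _ relT; have [H' [vH' mH' zH']] := ex _ relT'.
rewrite -mH -mH'; apply: (join_halves_conn vm); apply: hc; split=> //.
  by move=> j e eS; rewrite zH ?zH'.
have hsum (H0 : {ffun I * bool -> {ffun E -> nat}}) e :
    \sum_j H0 j e = \sum_k (H0 (k, false) e + H0 (k, true) e).
  transitivity (\sum_k \sum_b H0 (k, b) e).
    by rewrite pair_bigA /=; apply: eq_bigr => -[].
  by apply: eq_bigr => k _; rewrite big_bool addnC.
move=> e; have [eS|eS] := boolP (e \in S); last first.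
  by apply: eq_bigr => j _; rewrite zH ?zH'.
have : \sum_k T k e = \sum_k T' k e.
  by case: relT relT' => [_ _ _ s] [_ _ _ s']; rewrite -s s'.
have E0 H0 T0 k : join_halves B (mem S) H0 = T0 ->
    T0 k e = H0 (k, false) e + H0 (k, true) e.
  by move=> <-; rewrite !ffunE /= eS.
rewrite (hsum H) (hsum H') => sums.
rewrite (eq_bigr (fun k => T k e)) => [|k _]; last by rewrite (E0 _ _ k mH).
by rewrite sums; apply: eq_bigr => k _; rewrite (E0 _ _ k mH').
Qed.

End Halves.

Section TreeHalves.
Variables (I E : finType) (A : Type) (V : I -> {ffun E -> nat} -> bool) (l : I -> nat).
Implicit Types (T : {ffun I -> {ffun E -> nat}}) (t : btree A E) (w : {ffun E -> nat}).

(** A row of level 2 has two halves of level 1; a row of level 1 gets a second half of level 0, so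
    that all halves are indexed by [I * bool]. *)
Definition half_level (j : I * bool) : nat := if j.2 then (l j.1).-1 else 1.

Lemma tree_wtD t L1 L2 p1 p2 w1 w2 w : tree_wt t L1 p1 w1 -> tree_wt t L2 p2 w2 ->
    {in tree_edges t, forall e, w e = w1 e + w2 e} ->
  tree_wt t (L1 + L2) (p1 + p2) w.
Proof.
elim: t p1 p2 => [|v a b ta IHa tb IHb] p1 p2 /=; first by move=> *; exact: leq_add.
move=> /and3P[d1 a1 b1] /and3P[d2 a2 b2] s.
rewrite !s ?inE ?eqxx ?orbT // admissibleD //= IHa ?IHb // => e et; apply: s;
by rewrite !inE mem_cat et !orbT.
Qed.

Hypothesis l12 : forall k, 0 < l k <= 2.

Lemma half_level_le j : half_level j <= 1.
Proof. by case: j => k []; rewrite /half_level //=; have := l12 k; lia. Qed.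

Lemma half_levelD k : half_level (k, false) + half_level (k, true) = l k.
Proof. by rewrite /half_level /=; have := l12 k; lia. Qed.

Lemma tree_agree t P T T' :
    (forall k w, V k w -> ~~ odd (P k w)) -> uniq (tree_edges t) ->
    fragment V l (tree_edges t) P (tree_wt t) -> related V (tree_edges t) T T' ->
  conn V T T'.
Proof.
move=> Pev ut fr rel; have [vT vT' off _] := rel.
pose c (k : I) := (P k (T k))./2.
have cE k : P k (T k) = c k + c k.
  by have := odd_double_half (P k (T k)); rewrite (negPf (Pev _ _ (vT k))) -addnn.
have cle k : c k <= 1 /\ c k <= half_level (k, true).
  have := tree_wt_le (fragment_ok fr (vT k)); have := l12 k.
  by rewrite cE /half_level /=; lia.
pose Vh (j : I * bool) w := tree_wt t (half_level j) (c j.1) w.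
apply: (@halves_conn _ _ _ Vh (tree_edges t) T) => //.
- move=> H vH k; apply: (fragment_replace fr (vT k)) => [e /negPf eS|].
    by rewrite !ffunE /= eS.
  rewrite cE -half_levelD; apply: tree_wtD (vH (k, false)) (vH (k, true)) _ => e eS.
  by rewrite !ffunE /= eS.
- move=> k w vw offw; have := fragment_ok fr vw.
  rewrite (fragment_inv fr k offw) -half_levelD add1n => wt.
  have [c1 c2] := cle k.
  have [h1 [h2 [t1 t2 s]]] := tree_split ut wt (cE k) c1 c2.
  by exists (fun b => if b then h2 else h1) => // -[].
- by move=> j w w' /tree_wt_eq ww'; rewrite /Vh ww'.
- move=> H H' relH.
  apply: (@tree_conn _ _ Vh half_level _ t (fun j _ => c j.1) _ _ half_level_le ut _ relH).
  by split=> // L p w w'; exact: tree_wt_eq.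
Qed.

(** Here the root weight itself belongs to the table. The first half of a row takes as much of it as
    level 1 permits. Half rows of level 1 are exchanged as a whole until the root weights agree, and
    then [tree_conn] applies. *)
Lemma rooted_tree_conn t (r : E) T T' : uniq (r :: tree_edges t) ->
    (forall e, e \in r :: tree_edges t) -> (forall k w, V k w = tree_wt t (l k) (w r) w) ->
    valid V T -> valid V T' -> same_sums T T' ->
  conn V T T'.
Proof.
move=> /= /andP[rt ut] cover VE vT vT' sums.
set S := r :: tree_edges t; have allS T1 T2 : valid V T1 -> valid V T2 ->
    same_sums T1 T2 -> related V S T1 T2.
  by move=> v1 v2 s; split=> // k e; rewrite cover.
pose Vh (j : I * bool) w := tree_wt t (half_level j) (w r) w.
have loc (w w' : {ffun E -> nat}) L : {in S, w =1 w'} ->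
    tree_wt t L (w r) w = tree_wt t L (w' r) w'.
  move=> ww'; rewrite ww' ?mem_head //; apply: tree_wt_eq => e et.
  by apply: ww'; rewrite inE et orbT.
apply: (@halves_conn _ _ _ Vh S T) => //; try exact: allS.
- move=> H vH k; rewrite VE -half_levelD !ffunE /= mem_head.
  apply: tree_wtD (vH (k, false)) (vH (k, true)) _ => e eS.
  by rewrite !ffunE /= inE eS orbT.
- move=> k w vw _; rewrite VE -half_levelD add1n in vw.
  have le := tree_wt_le vw.
  have [||| h1 [h2 [t1 t2 s]]] := tree_split (p1 := minn 1 (w r))
    (p2 := w r - minn 1 (w r)) ut vw; rewrite ?subnKC ?geq_minl ?geq_minr //; first by lia.
  have upd (p : nat) (h : {ffun E -> nat}) : exists h' : {ffun E -> nat},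
      h' r = p /\ {in tree_edges t, h' =1 h}.
    exists [ffun e => if e == r then p else h e]; split=> [|e et]; rewrite ffunE ?eqxx //.
    by have [er|//] := eqVneq e r; rewrite -er et in rt.
  have [g1 [r1 e1]] := upd (minn 1 (w r)) h1; have [g2 [r2 e2]] := upd (w r - minn 1 (w r)) h2.
  exists (fun b : bool => if b then g2 else g1) => [[]|e]; rewrite /Vh /=.
  + by rewrite r2 (tree_wt_eq _ _ e2).
  + by rewrite r1 (tree_wt_eq _ _ e1).
  + rewrite inE => /predU1P[->|et]; first by rewrite r1 r2 subnKC ?geq_minr.
    by rewrite e1 // e2 // s.
- by move=> j w w' ww'; rewrite /Vh (loc _ _ _ ww').
move=> H H' relH.
have fr : fragment Vh half_level S (fun _ _ => 0) (fun L _ w => tree_wt t L (w r) w).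
  by split=> // L p w w'; exact: loc.
have lle k : valid Vh k -> forall j, k j r <= half_level j <= 1.
  by move=> vk j; rewrite half_level_le (tree_wt_le (vk j)).
have [||H1 [H2 [[rel1 e1] c1 _ re]]] := @balance2 _ _ Vh
    (fun H1 H2 => related Vh S H1 H2 /\ H2 = H') (fun H j => H j r) _ _ _ _ (conj relH erefl).
- by move=> H1 H2 [[_ _ _ s] _]; exact: s.
- move=> H1 H2 k m [rel0 e0] ltk ltm; have [v1 v2 _ _] := rel0.
  have km : k != m by apply/eqP => km; subst m; lia.
  have k1 := lle _ v1 k; have k2 := lle _ v2 k.
  have m1 := lle _ v1 m; have m2 := lle _ v2 m.
  have [||rel1 c1] := related_swap fr (fun e He => He) rel0 km; [by lia|by []|].
  exists (swap_on (mem S) k m H1), H2.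
  have [ek em off] := @swap_onE _ _ (mem S) k m H1 r (mem_head _ _) km.
  split=> //; [exact: conn_refl|by rewrite ek em; lia|].
  by move=> i ik im; rewrite off.
subst H2; apply: (conn_trans c1).
apply: (@tree_conn _ _ Vh half_level _ t (fun _ w => w r) _ _ half_level_le ut).
  split=> // [L p w w'|j w w' off|j w w' vw off wt]; [exact: tree_wt_eq|exact: off|].
  by rewrite /Vh off.
apply: (related_sub _ rel1) => [e et|j e]; first by rewrite inE et orbT.
by rewrite inE => /predU1P[->//|->].
Qed.

End TreeHalves.

(** * Chains of blobs *)

Section ChainWeights.
Variables (A : Type) (E : finType).
Implicit Types (s : seq (E * E * E)) (t : btree A E) (w : {ffun E -> nat}).

(* A blob [(y, z, x)] has the parallel edges [y] and [z] and the outgoing link *)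
(* [x]; the loop at v_1 is a blob with [y = z] and incoming value 0. *)
Fixpoint chain_edges s t : seq E :=
  if s is (y, z, x) :: s' then [:: y, z, x & chain_edges s' t] else tree_edges t.

Definition blob_wt L p y z q := admissible L p y z && admissible L y z q.

Fixpoint chain_wt s t L p w : bool :=
  if s is (y, z, x) :: s' then
    blob_wt L p (w y) (w z) (w x) && chain_wt s' t L (w x) w
  else tree_wt t L p w.

(** The edges [y] and [z] of one blob may coincide, as they do for the loop. *)
Fixpoint chain_layout s t : bool :=
  if s is (y, z, x) :: s' then
    [&& (x != y) && (x != z), y \notin chain_edges s' t, z \notin chain_edges s' t,
        x \notin chain_edges s' t & chain_layout s' t]
  else uniq (tree_edges t).

Lemma chain_wt_eq s t L p w w' : {in chain_edges s t, w =1 w'} ->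
  chain_wt s t L p w = chain_wt s t L p w'.
Proof.
elim: s p => [|[[y z] x] s IH] p /= ww'; first exact: tree_wt_eq.
rewrite !ww' ?inE ?eqxx ?orbT // IH // => e es; apply: ww'.
by rewrite !inE es !orbT.
Qed.

(** Parity and the triangle inequalities leave three kinds of blob: both links 0, both links 2, or
    one of each. All comparisons of blobs below rest on this list. *)
Lemma blobE L p y z q : 0 < L <= 2 -> ~~ odd p ->
  blob_wt L p y z q = [|| [&& p == 0, q == 0, y == z & y <= L],
    [&& L == 2, p == 2, q == 2 & y + z == 2]
  | [&& L == 2, p + q == 2, p != 1, y == 1 & z == 1]].
Proof. by rewrite /blob_wt /admissible => L12 p2; apply/idP/idP; lia. Qed.

Lemma blob_wt_even L p y z q : ~~ odd p -> blob_wt L p y z q -> ~~ odd q.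
Proof. by rewrite /blob_wt /admissible => p2; lia. Qed.

Section TwoBlobs.
Variables L p y z q y' z' q' : nat.
Hypotheses (L12 : 0 < L <= 2) (p2 : ~~ odd p).
Hypotheses (b : blob_wt L p y z q) (b' : blob_wt L p y' z' q').

(** This lemma and the next two compare blobs with a common incoming link in the order in which they
    will be matched: outgoing link, sum of the parallel weights, single parallel weight. Each
    difference pins down the kind of blob. *)
Lemma blob_lt_out : q < q' -> [/\ L = 2, q = 0, q' = 2
  & (p = 0 /\ y' = 1 /\ z' = 1) \/ (p = 2 /\ y = 1 /\ z = 1)].
Proof. by move: b b'; rewrite !blobE // => bl bl' lt; split; lia. Qed.

Lemma blob_lt_sum : q = q' -> y + z < y' + z' ->
  [/\ p = 0, q = 0, y = z, y' = z' & y' <= L].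
Proof. by move: b b'; rewrite !blobE // => bl bl' qq lt; split; lia. Qed.

Lemma blob_lt_para : q = q' -> y + z = y' + z' -> y < y' ->
  [/\ L = 2, p = 2, q = 2 & y + z = 2].
Proof. by move: b b'; rewrite !blobE // => bl bl' qq yz lt; split; lia. Qed.

End TwoBlobs.

End ChainWeights.

(** * Matching two tables from left to right along the chain *)

Section ChainConn.
Variables (I E : finType) (A : Type) (V : I -> {ffun E -> nat} -> bool) (l : I -> nat).
Implicit Types (T : {ffun I -> {ffun E -> nat}}) (t : btree A E) (w : {ffun E -> nat}).
Implicit Types (s : seq (E * E * E)) (k m i : I) (e : E).
Hypothesis l12 : forall k, 0 < l k <= 2.

Section Blob.
Variables (y z x : E) (s : seq (E * E * E)) (t : btree A E).
Variable P : I -> {ffun E -> nat} -> nat.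
Let tail := chain_edges s t.
Let S := [:: y, z, x & tail].
Hypothesis layout : chain_layout ((y, z, x) :: s) t.
Hypothesis Peven : forall k w, V k w -> ~~ odd (P k w).
Hypothesis fr : fragment V l S P (chain_wt ((y, z, x) :: s) t).

Let layoutP : [/\ (x != y) && (x != z), y \notin tail, z \notin tail & x \notin tail].
Proof. by have /and5P[? ? ? ? ?] := layout. Qed.

Lemma fragment_tail : fragment V l tail (fun _ w => w x) (chain_wt s t).
Proof.
have [/andP[xy xz] yt zt xt] := layoutP.
apply: (fragment_sub fr) => [e et|L p w w' ew|k w /andP[] //|k w w' off|].
- by rewrite /= !inE et !orbT.
- exact: chain_wt_eq.
- exact: off.
- by move=> k w w' /andP[adm _] off wt; rewrite /= !off // adm.
Qed.

Let blob T k : valid V T -> blob_wt (l k) (P k (T k)) (T k y) (T k z) (T k x).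
Proof. by move=> vT; have /andP[] := fragment_ok fr (vT k). Qed.

Let tail_wt T k : valid V T -> chain_wt s t (l k) (T k x) (T k).
Proof. by move=> vT; have /andP[] := fragment_ok fr (vT k). Qed.

Let Pe T k : valid V T -> ~~ odd (P k (T k)).
Proof. by move=> vT; exact: Peven (vT k). Qed.

Let replace T k w : valid V T -> (forall e, e \notin S -> w e = T k e) ->
    blob_wt (l k) (P k (T k)) (w y) (w z) (w x) -> chain_wt s t (l k) (w x) w ->
  V k w.
Proof.
by move=> vT off b ct; apply: (fragment_replace fr (vT k) off); apply/andP.
Qed.

(** Two rows with links (p, q) and (q, p) and parallel weights 1 become (p, p) and (q, q): the
    parallel weights stay, while the outgoing links and all that follows are exchanged. *)
Lemma swap_tail T T' k m : related V S T T' -> k != m -> l k = 2 -> l m = 2 ->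
    P k (T k) = T m x -> P m (T m) = T k x -> T m x <= 2 -> T k x <= 2 ->
    T k y = 1 -> T k z = 1 -> T m y = 1 -> T m z = 1 ->
  let T1 := swap_on (mem (x :: tail)) k m T in related V S T1 T' /\ conn V T T1.
Proof.
move=> rel km lk lm Pk Pm mx kx ky kz my mz T1; have [vT _ _ _] := rel.
have [/andP[xy xz] yt zt xt] := layoutP.
have new i j : l i = 2 -> l j = 2 -> P i (T i) = T j x -> T j x <= 2 ->
    T i y = 1 -> T i z = 1 -> V i (pick_on (mem (x :: tail)) (T j) (T i)).
  move=> li lj Pi jx iy iz; have Pie := Pe i vT.
  have on e : e \in x :: tail -> pick_on (mem (x :: tail)) (T j) (T i) e = T j e.
    by move=> et; rewrite ffunE /= et.
  have offt e : e \notin x :: tail -> pick_on (mem (x :: tail)) (T j) (T i) e = T i e.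
    by move=> /negPf et; rewrite ffunE /= et.
  apply: replace => // [e|| ].
  - by rewrite !inE !negb_or => /and4P[_ _ ex et]; rewrite offt // inE negb_or ex.
  - rewrite (on x) ?mem_head // (offt y) ?(offt z) ?inE ?negb_or ?yt ?zt ?andbT 1?eq_sym //.
    by rewrite blobE ?l12 ?Pe // li iy iz -Pi; rewrite -Pi in jx; lia.
  - rewrite (on x) ?mem_head // li -lj (@chain_wt_eq _ _ s t _ _ _ (T j)); first exact: tail_wt.
    by move=> e et; rewrite on // inE et orbT.
have [v1 c1] := swap_conn vT km (new k m lk lm Pk mx ky kz) (new m k lm lk Pm kx my mz).
split=> //; apply: (related_conn rel v1 c1) => i e eS.
have et : e \notin x :: tail by apply: contra eS; rewrite !inE => ->; rewrite !orbT.
exact: swap_on_off.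
Qed.

(* If row [k] has values (0, 0) and row [m] has (2, 2) at the two links of the  *)
(* blob, while the target has (0, 2) and (2, 0), no move of the first table     *)
(* helps, but the target can be moved towards it: so both tables are modified.  *)
Lemma balance_out T T' : related V S T T' ->
  exists T1 T1', [/\ related V S T1 T1', conn V T T1, conn V T' T1'
    & forall k, T1 k x = T1' k x].
Proof.
have xS : x \in S by rewrite !inE eqxx !orbT.
move=> rel; apply: (@balance2 _ _ V (related V S) (fun T k => T k x)) rel => //.
  by move=> T0 T0' [_ _ _ sums]; exact: sums.
move=> {}T {}T' k m rel ltk ltm; have [vT vT' _ _] := rel.
have km : k != m by apply/eqP => km; subst m; lia.
have Pk := related_inv k fr rel; have Pm := related_inv m fr rel.
have bk' := blob k vT'; have bm' := blob m vT'; rewrite -Pk in bk'; rewrite -Pm in bm'.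
have [lk kx kx' ck] := blob_lt_out (l12 k) (Pe k vT) (blob k vT) bk' ltk.
have [lm mx' mx cm] := blob_lt_out (l12 m) (Pe m vT) bm' (blob m vT) ltm.
have lkm : l k = l m by rewrite lk lm.
have [Pkm|Pkm] := eqVneq (P k (T k)) (P m (T m)).
  have [rel1 c1] := related_swap fr (fun e He => He) rel km lkm Pkm.
  have [ek em off] := @swap_onE _ _ (mem S) k m T x xS km.
  exists (swap_on (mem S) k m T), T'; split=> //; first exact: conn_refl.
    by rewrite ek em; lia.
  by move=> i ik im; rewrite off.
case: ck cm => [[Pk0 [ky kz]]|[Pk2 [ky kz]]] [[Pm0 [my mz]]|[Pm2 [my mz]]];
  try by rewrite ?Pk0 ?Pk2 ?Pm0 ?Pm2 ?eqxx in Pkm.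
- have [||||||||||rel1 c1] := swap_tail (related_sym rel) km; rewrite -?Pk -?Pm ?kx' ?mx' //.
  have [ek em off] := @swap_onE _ _ (mem (x :: tail)) k m T' x (mem_head _ _) km.
  exists T, (swap_on (mem (x :: tail)) k m T'); split=> //; first exact: related_sym.
  + exact: conn_refl.
  + by rewrite ek em; lia.
  + by move=> i ik im; rewrite off.
(* The mirrored case: the first table has links (2, 0) and (0, 2), so it is the one to change. *)
- have [||||||||||rel1 c1] := swap_tail rel km; rewrite ?kx ?mx //.
  have [ek em off] := @swap_onE _ _ (mem (x :: tail)) k m T x (mem_head _ _) km.
  exists (swap_on (mem (x :: tail)) k m T), T'; split=> //; first exact: conn_refl.
  + by rewrite ek em; lia.
  + by move=> i ik im; rewrite off.
Qed.

(** Blobs that differ in the sum have both links 0 and equal parallel weights, so one unit on both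
    parallel edges can pass from one row to another. [shift] acts edge by edge, hence changes a loop
    [y = z] only once. *)
Lemma balance_sum T T' : related V S T T' -> (forall k, T k x = T' k x) ->
  exists T1, [/\ related V S T1 T', conn V T T1
    & forall k, T1 k x = T' k x /\ T1 k y + T1 k z = T' k y + T' k z].
Proof.
have [/andP[xy xz] yt zt xt] := layoutP.
move=> rel out.
pose Q T0 T0' := [/\ related V S T0 T0', T0' = T' & forall k, T0 k x = T0' k x].
have [||T1 [T2 [[rel1 e1 out1] c1 _ sum1]]] :=
    @balance2 _ _ V Q (fun T k => T k y + T k z) _ _ T T' (And3 rel erefl out).
- by move=> T0 T0' [[_ _ _ sums] _ _]; rewrite !big_split /= !sums.
- move=> T0 T0' k m [rel0 e0 out0] ltk ltm; have [v0 v0' off0 _] := rel0.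
  have km : k != m by apply/eqP => km; subst m; lia.
  have Pk := related_inv k fr rel0; have Pm := related_inv m fr rel0.
  have bk' := blob k v0'; have bm' := blob m v0'; rewrite -Pk in bk'; rewrite -Pm in bm'.
  have [pk qk yzk yzk' lek] :=
    blob_lt_sum (l12 k) (Pe k v0) (blob k v0) bk' (out0 k) ltk.
  have [pm qm yzm' yzm lem] :=
    blob_lt_sum (l12 m) (Pe m v0) bm' (blob m v0) (esym (out0 m)) ltm.
  pose shift (f : nat -> nat) w : {ffun E -> nat} :=
    [ffun e => if (e == y) || (e == z) then f (w e) else w e].
  have new f i : P i (T0 i) = 0 -> T0 i x = 0 -> T0 i y = T0 i z -> f (T0 i y) <= l i ->
      V i (shift f (T0 i)).
    move=> pi qi yzi le; apply: replace => // [e||].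
    + by rewrite !inE !negb_or => /and4P[/negPf ey /negPf ez _ _]; rewrite ffunE ey ez.
    + rewrite !ffunE !eqxx orbT (negPf xy) (negPf xz) /= -yzi.
      by rewrite blobE ?l12 ?Pe // pi qi !eqxx le.
    + rewrite ffunE (negPf xy) (negPf xz) (@chain_wt_eq _ _ s t _ _ _ (T0 i)).
        exact: tail_wt.
      move=> e et; rewrite ffunE; have [ey|_] := eqVneq e y; first by rewrite -ey et in yt.
      by have [ez|_] := eqVneq e z; first by rewrite -ez et in zt.
  have [||e|v1 c1] := @replace2_conn _ _ V k m (shift succn (T0 k)) (shift predn (T0 m)) T0 v0 km.
  + by apply: new => //; move: ltk yzk yzk' lek; clear; lia.
  + by apply: new => //; [rewrite out0|move: lem; clear; lia].
  + rewrite !ffunE; case: ifP => // /orP[]/eqP->; move: ltm yzm yzm'; clear; lia.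
  have rel1 : related V S (replace2 k m (shift succn (T0 k)) (shift predn (T0 m)) T0) T0'.
    apply: (related_conn rel0 v1 c1) => i e.
    rewrite !inE !negb_or => /and4P[/negPf ey /negPf ez _ _]; rewrite ffunE.
    by case: eqP => [->|_]; [|case: eqP => [->|//]]; rewrite ffunE ey ez.
  exists (replace2 k m (shift succn (T0 k)) (shift predn (T0 m)) T0), T0'; split=> //.
  + split=> // i; rewrite -out0 ffunE.
    by case: eqP => [->|_]; [|case: eqP => [->|//]]; rewrite ffunE (negPf xy) (negPf xz).
  + exact: conn_refl.
  + rewrite replace2l replace2r // !ffunE !eqxx orbT /=.
    by move: ltk ltm yzk yzk' yzm yzm'; clear; lia.
  + by move=> i ik im; rewrite replace2_off.
by subst T2; exists T1; split.
Qed.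

(** Blobs that still differ have both links 2 and parallel weights of sum 2. One row moves a unit
    from [z] to [y], the other moves one back. *)
Lemma balance_para T T' : related V S T T' ->
    (forall k, T k x = T' k x /\ T k y + T k z = T' k y + T' k z) ->
  exists T1, [/\ related V S T1 T', conn V T T1
    & forall k, [/\ T1 k x = T' k x, T1 k y = T' k y & T1 k z = T' k z]].
Proof.
have [/andP[xy xz] yt zt xt] := layoutP.
move=> rel out.
pose Q T0 T0' := [/\ related V S T0 T0', T0' = T'
  & forall k, T0 k x = T0' k x /\ T0 k y + T0 k z = T0' k y + T0' k z].
have [||T1 [T2 [[rel1 e1 out1] c1 _ sum1]]] :=
    @balance2 _ _ V Q (fun T k => T k y) _ _ T T' (And3 rel erefl out).
- by move=> T0 T0' [[_ _ _ sums] _ _]; rewrite sums.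
- move=> T0 T0' k m [rel0 e0 out0] ltk ltm; have [v0 v0' off0 _] := rel0.
  have km : k != m by apply/eqP => km; subst m; lia.
  have Pk := related_inv k fr rel0; have Pm := related_inv m fr rel0.
  have [qk' sk'] := out0 k; have [qm' sm'] := out0 m.
  have bk' := blob k v0'; have bm' := blob m v0'; rewrite -Pk in bk'; rewrite -Pm in bm'.
  have [lk pk qk sk] :=
    blob_lt_para (l12 k) (Pe k v0) (blob k v0) bk' qk' sk' ltk.
  have [lm pm qm sm] :=
    blob_lt_para (l12 m) (Pe m v0) bm' (blob m v0) (esym qm') (esym sm') ltm.
  (* On a loop, equal sums would force equal weights. *)
  have yz : z != y by apply/eqP => zy; move: sk' ltk; rewrite zy; clear; lia.
  pose shift (f g : nat -> nat) w : {ffun E -> nat} :=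
    [ffun e => if e == y then f (w e) else if e == z then g (w e) else w e].
  have new f g i : l i = 2 -> P i (T0 i) = 2 -> T0 i x = 2 ->
      f (T0 i y) + g (T0 i z) = 2 -> V i (shift f g (T0 i)).
    move=> li pi qi sum; apply: replace => // [e||].
    + by rewrite !inE !negb_or => /and4P[/negPf ey /negPf ez _ _]; rewrite ffunE ey ez.
    + rewrite !ffunE !eqxx (negPf xy) (negPf xz) (negPf yz) /=.
      by rewrite blobE ?l12 ?Pe // pi qi sum li !eqxx !orbT.
    + rewrite ffunE (negPf xy) (negPf xz) (@chain_wt_eq _ _ s t _ _ _ (T0 i)).
        exact: tail_wt.
      move=> e et; rewrite ffunE; have [ey|_] := eqVneq e y; first by rewrite -ey et in yt.
      by have [ez|_] := eqVneq e z; first by rewrite -ez et in zt.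
  have [||e|v1 c1] := @replace2_conn _ _ V k m (shift succn predn (T0 k))
    (shift predn succn (T0 m)) T0 v0 km.
  + by apply: new => //; move: ltk sk' sk; clear; lia.
  + by apply: new => //; [rewrite qm'|move: ltm sm' sm; clear; lia].
  + rewrite !ffunE; case: eqP => [->|_]; first by move: ltm; clear; lia.
    by case: eqP => [->|_] //; move: ltk sk'; clear; lia.
  have rel1 : related V S (replace2 k m (shift succn predn (T0 k))
      (shift predn succn (T0 m)) T0) T0'.
    apply: (related_conn rel0 v1 c1) => i e.
    rewrite !inE !negb_or => /and4P[/negPf ey /negPf ez _ _]; rewrite ffunE.
    by case: eqP => [->|_]; [|case: eqP => [->|//]]; rewrite ffunE ey ez.
  exists (replace2 k m (shift succn predn (T0 k)) (shift predn succn (T0 m)) T0), T0'.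
  split=> //.
  + split=> // i; have [<- <-] := out0 i; rewrite ffunE.
    case: eqP => [->|_]; [|case: eqP => [->|//]];
    rewrite !ffunE (negPf xy) (negPf xz) !eqxx (negPf yz); split=> //;
    move: ltk ltm sk sm sk' sm'; clear; lia.
  + exact: conn_refl.
  + rewrite replace2l replace2r // !ffunE !eqxx /=.
    by move: ltk ltm; clear; lia.
  + by move=> i ik im; rewrite replace2_off.
subst T2; exists T1; split=> // k; have [? sk] := out1 k; have := sum1 k.
by move=> yk; split=> //; move: sk; rewrite yk => /addnI.
Qed.

Lemma chain_step T T' : related V S T T' ->
  exists T1 T1', [/\ related V tail T1 T1', conn V T T1 & conn V T' T1'].
Proof.
move=> /balance_out[T1 [T1' [rel1 c1 c1' out1]]].
have [T2 [rel2 c2 out2]] := balance_sum rel1 out1.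
have [T3 [rel3 c3 out3]] := balance_para rel2 out2.
exists T3, T1'; split=> //; last by apply: conn_trans c1 (conn_trans c2 c3).
apply: (related_sub _ rel3) => [e et|k e]; first by rewrite !inE et !orbT.
by rewrite !inE => /or4P[/eqP->|/eqP->|/eqP->|->] // _; case: (out3 k).
Qed.

End Blob.

(** The outgoing link of a blob is the incoming link of the rest and is even again. As [chain_step]
    may move the target too, that part of the path is traversed backwards. At the end of the chain
    [tree_agree] takes over. *)
Lemma chain_conn s t P T T' : chain_layout s t ->
    (forall k w, V k w -> ~~ odd (P k w)) ->
    fragment V l (chain_edges s t) P (chain_wt s t) -> related V (chain_edges s t) T T' ->
  conn V T T'.
Proof.
elim: s P T T' => [|[[y z] x] s IH] P T T' lay Pev fr rel.
  exact: (tree_agree l12 Pev lay fr rel).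
have [T1 [T1' [rel1 c1 c1']]] := chain_step lay Pev fr rel.
have [_ vT' _ _] := rel.
apply: (conn_trans c1); apply: conn_trans (conn_sym vT' c1').
apply: (IH _ _ _ _ _ (fragment_tail lay fr) rel1); first by case/and5P: lay.
by move=> k w vw; have /andP[/blob_wt_even ->] := fragment_ok fr vw; rewrite ?Pev.
Qed.

End ChainConn.

(** * Splitting off a weighting of level 2 *)

Section Peel.
Variables (A : Type) (E : finType).
Implicit Types (s : seq (E * E * E)) (t : btree A E) (w : {ffun E -> nat}).

(** Two splittings of level 1 in succession, each taking as much of the root value as it can; their
    level 1 parts add up to [r]. *)
Lemma tree_peel t L p w : uniq (tree_edges t) -> tree_wt t L.+2 p w ->
  exists r r', [/\ tree_wt t 2 (minn 2 p) r, tree_wt t L (p - minn 2 p) r'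
    & {in tree_edges t, forall e, w e = r e + r' e}].
Proof.
move=> ut wt; have le := tree_wt_le wt.
have [||| h1 [h2 [t1 t2 s1]]] := tree_split (p1 := minn 1 p)
    (p2 := p - minn 1 p) ut wt; [by lia..|].
have [||| h3 [h4 [t3 t4 s3]]] := tree_split (p1 := minn 1 (p - minn 1 p))
    (p2 := p - minn 2 p) ut t2; [by lia..|].
exists [ffun e => h1 e + h3 e], h4; split=> //.
  have -> : minn 2 p = minn 1 p + minn 1 (p - minn 1 p) by lia.
  by apply: (tree_wtD t1 t3) => e et; rewrite ffunE.
by move=> e et; rewrite s1 // s3 // ffunE addnA.
Qed.

(** With the parities fixed the conditions are linear inequalities, which can be checked separately
    for summand and remainder. *)
Lemma blob_wt_ineq L p y z q : ~~ odd p -> ~~ odd q -> ~~ odd (y + z) ->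
  blob_wt L p y z q = [&& p <= y + z, q <= y + z, y <= z + p, z <= y + p,
    y <= z + q, z <= y + q, y + z + p <= 2 * L & y + z + q <= 2 * L].
Proof.
rewrite /blob_wt /admissible => p2 q2 yz2.
have -> : odd (p + y + z) = false by rewrite -addnA oddD (negPf p2) (negPf yz2).
have -> : odd (y + z + q) = false by rewrite oddD (negPf q2) (negPf yz2).
by apply/idP/idP; lia.
Qed.

Lemma blob_wt_sum_even L p y z q : ~~ odd p -> blob_wt L p y z q -> ~~ odd (y + z).
Proof. by rewrite /blob_wt /admissible; lia. Qed.

(** A nonzero link is even, so it can give up 2. Equal parallel weights have to be split equally,
    because on the loop they are the weight of a single edge. *)
Lemma blob_split L p y z q : ~~ odd p -> blob_wt L.+3 p y z q ->
  exists y1 z1, [/\ blob_wt 2 (minn 2 p) y1 z1 (minn 2 q),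
    blob_wt L.+1 (p - minn 2 p) (y - y1) (z - z1) (q - minn 2 q),
    y1 <= y /\ z1 <= z & y = z -> y1 = z1].
Proof.
move=> p2 b; have q2 := blob_wt_even p2 b; have yz2 := blob_wt_sum_even p2 b.
move: b; rewrite blob_wt_ineq //.
(* What a choice of [y1] and [z1] must satisfy: parity and size, the inequalities of the summand (4
   is twice its level), and those of the remainder, written without subtraction. *)
have pick y1 z1 p1 q1 : minn 2 p = p1 -> minn 2 q = q1 -> (y = z -> y1 = z1) ->
    [&& ~~ odd p1, ~~ odd q1, ~~ odd (y1 + z1), p1 <= p, q1 <= q, y1 <= y & z1 <= z] ->
    [&& p1 <= y1 + z1, q1 <= y1 + z1, y1 <= z1 + p1, z1 <= y1 + p1, y1 <= z1 + q1,
        z1 <= y1 + q1, y1 + z1 + p1 <= 4 & y1 + z1 + q1 <= 4] ->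
    [&& p + y1 + z1 <= y + z + p1, q + y1 + z1 <= y + z + q1,
        y + z1 + p1 <= z + p + y1, z + y1 + p1 <= y + p + z1,
        y + z1 + q1 <= z + q + y1, z + y1 + q1 <= y + q + z1,
        y + z + p <= 2 * L.+1 + y1 + z1 + p1 & y + z + q <= 2 * L.+1 + y1 + z1 + q1] ->
    exists y1 z1, [/\ blob_wt 2 (minn 2 p) y1 z1 (minn 2 q),
      blob_wt L.+1 (p - minn 2 p) (y - y1) (z - z1) (q - minn 2 q),
      y1 <= y /\ z1 <= z & y = z -> y1 = z1].
  move=> -> -> yz /and5P[p12 q12 yz12 ple /and3P[qle yle zle]] c1 c2.
  exists y1, z1; split=> //; first by rewrite blob_wt_ineq.
  rewrite blob_wt_ineq; first by move: ple qle yle zle c2; clear; lia.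
  - by move: p2 p12 ple; clear; lia.
  - by move: q2 q12 qle; clear; lia.
  - by move: yz2 yz12 yle zle; clear; lia.
(* Without links, each parallel edge gives up to 2; with one nonzero link, each gives 1; with two,
   the heavier edge gives 2, or each gives 1 if they are equal. *)
have [p0|p0] := posnP p; have [q0|q0] := posnP q => b.
- by apply: (pick (minn 2 y) (minn 2 y) 0 0); move: p0 q0 b; clear; lia.
- by apply: (pick 1 1 0 2); move: p0 q0 q2 b; clear; lia.
- by apply: (pick 1 1 2 0); move: p0 q0 p2 b; clear; lia.
have [lt|lt|eq] := ltngtP y z.
- by apply: (pick 0 2 2 2); move: p0 q0 p2 q2 yz2 lt b; clear; lia.
- by apply: (pick 2 0 2 2); move: p0 q0 p2 q2 yz2 lt b; clear; lia.
- by apply: (pick 1 1 2 2); move: p0 q0 p2 q2 eq b; clear; lia.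
Qed.

Lemma chain_peel s t L p w : chain_layout s t -> ~~ odd p -> chain_wt s t L.+3 p w ->
  exists r r', [/\ chain_wt s t 2 (minn 2 p) r, chain_wt s t L.+1 (p - minn 2 p) r'
    & {in chain_edges s t, forall e, w e = r e + r' e}].
Proof.
elim: s p => [|[[y z] x] s IH] p /=; first by move=> ut _; exact: tree_peel.
move=> /and5P[/andP[xy xz] yt zt xt lay] pev /andP[b wt].
have [y1 [z1 [b1 b2 [y1le z1le] yz]]] := blob_split pev b.
have [r [r' [wr wr' s1]]] := IH _ lay (blob_wt_even pev b) wt.
(* If [y = z], the first test decides, and the values prescribed for [y] and [z] are equal. *)
pose h (a b c : nat) (f : {ffun E -> nat}) : {ffun E -> nat} := [ffun e => if e == y then a else
  if e == z then b else if e == x then c else f e].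
have hE a b0 c f : (y = z -> a = b0) -> [/\ h a b0 c f y = a, h a b0 c f z = b0, h a b0 c f x = c
    & {in chain_edges s t, h a b0 c f =1 f}].
  move=> eyz; rewrite !ffunE !eqxx (negPf xy) (negPf xz); split=> // [|e es].
    by case: eqP => // zy; rewrite eyz.
  rewrite ffunE; have [ey|_] := eqVneq e y; first by rewrite -ey es in yt.
  have [ez|_] := eqVneq e z; first by rewrite -ez es in zt.
  by have [ex|//] := eqVneq e x; rewrite -ex es in xt.
have [|ry rz rx rt] := hE y1 z1 (minn 2 (w x)) r; first by move=> yz'; apply: yz; rewrite yz'.
have [|ry' rz' rx' rt'] := hE (w y - y1) (w z - z1) (w x - minn 2 (w x)) r'.
  by move=> yz'; rewrite -yz yz'.
exists (h y1 z1 (minn 2 (w x)) r), (h (w y - y1) (w z - z1) (w x - minn 2 (w x)) r').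
split.
- by rewrite ry rz rx b1 (chain_wt_eq _ _ rt).
- by rewrite ry' rz' rx' b2 (chain_wt_eq _ _ rt').
- move=> e; rewrite !inE => /or4P[/eqP->|/eqP->|/eqP->|es].
  + by rewrite ry ry' subnKC.
  + by rewrite rz rz' subnKC.
  + by rewrite rx rx' subnKC // geq_minr.
  + by rewrite rt // rt' // s1.
Qed.

Lemma chain_wt0 s t p w : chain_wt s t 0 p w -> {in chain_edges s t, forall e, w e = 0}.
Proof.
elim: s p => [p /tree_wt0[] //|[[y z] x] s IH] p /= /andP[b /IH wt] e.
have [wy wz wx] : [/\ w y = 0, w z = 0 & w x = 0].
  by move: b; rewrite /blob_wt /admissible; split; lia.
by rewrite !inE => /or4P[/eqP->|/eqP->|/eqP->|/wt].
Qed.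

End Peel.

Section Decomposable.
Variables (A : Type) (E : finType).
Implicit Types (V : nat -> {ffun E -> nat} -> bool).

(** What the algebra needs to know about the graph. The first field gives the relations, the second
    generation; the third makes the unit the only block of level 0. *)
Record decomposable V : Prop := Decomposable {
  decomposable_conn : forall (I : finType) (l : I -> nat) (T T' : {ffun I -> {ffun E -> nat}}),
    (forall k, 0 < l k <= 2) -> let Vl k := V (l k) in
    valid Vl T -> valid Vl T' -> same_sums T T' -> conn Vl T T';
  decomposable_peel : forall L w, V L.+3 w ->
    exists r r', [/\ V 2 r, V L.+1 r' & forall e, w e = r e + r' e];
  decomposable0 : forall w e, V 0 w -> w e = 0
}.

Lemma rooted_tree_decomposable (t : btree A E) (r : E) V : uniq (r :: tree_edges t) ->
    (forall e, e \in r :: tree_edges t) ->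
    (forall L w, V L w = tree_wt t L (w r) w) -> decomposable V.
Proof.
move=> u cover VE; split.
- by move=> I l T T' l12 Vl vT vT'; apply: (rooted_tree_conn l12 u cover) => // k w; exact: VE.
- move=> L w; rewrite VE => wt; have /andP[rt ut] := u.
  have [h [h' [w1 w2 s]]] := tree_peel ut wt.
  have upd (p : nat) (f : {ffun E -> nat}) : exists g : {ffun E -> nat},
      g r = p /\ {in tree_edges t, g =1 f}.
    exists [ffun e => if e == r then p else f e]; split=> [|e et]; rewrite ffunE ?eqxx //.
    by have [er|//] := eqVneq e r; rewrite -er et in rt.
  have [g [gr gt]] := upd (minn 2 (w r)) h; have [g' [gr' gt']] := upd (w r - minn 2 (w r)) h'.
  exists g, g'; rewrite !VE gr gr' (tree_wt_eq _ _ gt) (tree_wt_eq _ _ gt') w1 w2.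
  split=> // e; have := cover e; rewrite inE => /predU1P[->|et].
    by rewrite gr gr' subnKC // geq_minr.
  by rewrite gt // gt' // s.
- move=> w e; rewrite VE => /tree_wt0[wr wt]; have := cover e.
  by rewrite inE => /predU1P[->|/wt].
Qed.

Lemma chain_decomposable s (t : btree A E) V : chain_layout s t ->
    (forall e, e \in chain_edges s t) ->
    (forall L w, V L w = chain_wt s t L 0 w) -> decomposable V.
Proof.
move=> lay cover VE; split.
- move=> I l T T' l12 Vl vT vT' sums.
  apply: (@chain_conn _ _ _ _ _ l12 s t (fun _ _ => 0)) => //; last first.
    by split=> // k e; rewrite cover.
  split=> // [L p w w'|k w|k w w' _ _]; first exact: chain_wt_eq.
    by rewrite /Vl VE.
  by rewrite /Vl VE.
- move=> L w; rewrite VE => /chain_peel[] // r [r' [w1 w2 s1]].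
  by exists r, r'; rewrite !VE; split=> // e; exact: s1.
- by move=> w e; rewrite VE => /chain_wt0; apply.
Qed.

End Decomposable.

(** * Trivalent trees as binary trees *)

Lemma admissible_perm L a b c a' b' c' :
  perm_eq [:: a; b; c] [:: a'; b'; c'] -> admissible L a b c = admissible L a' b' c'.
Proof.
(* The triangle inequalities say that no weight exceeds half of the sum, a form symmetric in the
   three weights. *)
have admE x y z : let s := [:: x; y; z] in admissible L x y z =
    [&& sumn s <= 2 * L, all (fun i => 2 * i <= sumn s) s & ~~ odd (sumn s)].
  by rewrite /admissible /=; apply/idP/idP; lia.
by move=> p; rewrite !admE (perm_sumn p) (perm_all _ p).
Qed.

Lemma admissible_at_perm (G : trigraph) L (w : {ffun edge G -> nat}) v x a b :
  perm_eq (inc v) [:: x; a; b] -> admissible_at L w v = admissible L (w x) (w a) (w b).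
Proof.
move=> /(perm_map w) p; rewrite /admissible_at; apply: admissible_perm.
apply: perm_trans p; rewrite (tnth_nth x) (tnth_nth x) (tnth_nth x) !inordK //.
by case: (inc v) => -[|y0 [|y1 [|y2 []]]].
Qed.

Section Walks.
Variable G : trigraph.
Implicit Types (e : edge G) (u v : vertex G) (s : seq (edge G * vertex G)).

Lemma joinsC e u v : joins e u v = joins e v u.
Proof. by rewrite /joins eq_sym; case: eqP => [->//|_]; rewrite andbC. Qed.

Lemma joins_mem e u v : joins e u v -> e \in inc u /\ e \in inc v.
Proof.
rewrite /joins; case: eqP => [<-|_ /andP[]//].
by rewrite -has_pred1 has_count => /ltnW.
Qed.

Lemma joins_neq e u v : u != v -> e \in inc u -> e \in inc v -> joins e u v.
Proof. by rewrite /joins => /negPf -> -> ->. Qed.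

Lemma walk_cat u s v s' v' : walk u s v -> walk v s' v' -> walk u (s ++ s') v'.
Proof. by elim: s u => [u /eqP-> //|[e u1] s IH u /= /andP[-> w] /(IH _ w)]. Qed.

Lemma walk_rev u s v : walk u s v ->
  exists2 s', walk v s' u & perm_eq [seq i.1 | i <- s'] [seq i.1 | i <- s].
Proof.
elim: s u => [u /= /eqP->|[e u1] s IH u /= /andP[j /IH[s' w p]]].
  by exists [::] => /=.
exists (s' ++ [:: (e, u)]).
  by apply: walk_cat w _; rewrite /= joinsC j eqxx.
by rewrite map_cat /= perm_catC /= perm_cons.
Qed.

Lemma mem_half_edges e : 0 < half_edges e -> exists v, e \in inc v.
Proof.
move=> h; have [/existsP[v ve]|/existsPn no] := boolP [exists v, e \in inc v].
  by exists v.
move: h; rewrite /half_edges big1 // => v _.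
by apply: count_memPn; exact: no.
Qed.

Lemma half_edges_seq e (vs : seq (vertex G)) : uniq vs ->
  \sum_(v <- vs) count_mem e (inc v) <= half_edges e.
Proof.
move=> u; rewrite big_uniq // /half_edges [leqRHS](bigID (mem vs)) /=.
exact: leq_addr.
Qed.

End Walks.

Section EmbeddedTrees.
Variable G : trigraph.
Implicit Types (e x y a b : edge G) (u v : vertex G).
Implicit Types (t ta tb : btree (vertex G) (edge G)).

(** The tree [t] is drawn in the graph below the edge [x]. Repetitions are ruled out separately, by
    [tree_ok]. *)
Fixpoint embedded x t : bool :=
  if t is Node v a b ta tb then
    [&& perm_eq (inc v) [:: x; a; b], embedded a ta & embedded b tb]
  else true.

Fixpoint tree_verts t : seq (vertex G) :=
  if t is Node v _ _ ta tb then v :: tree_verts ta ++ tree_verts tb else [::].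

(** The edges above a tip, where the drawn tree may still grow; [inner] collects those above a
    node. *)
Fixpoint outer x t : seq (edge G) :=
  if t is Node _ a b ta tb then outer a ta ++ outer b tb else [:: x].

Fixpoint inner x t : seq (edge G) :=
  if t is Node _ a b ta tb then x :: inner a ta ++ inner b tb else [::].

Lemma tree_wt_embedded x t L (w : {ffun edge G -> nat}) : embedded x t -> w x <= L ->
  tree_wt t L (w x) w = all (admissible_at L w) (tree_verts t).
Proof.
elim: t x => [x //|v a b ta IHa tb IHb] x /= /and3P[p ea eb] xle.
rewrite (admissible_at_perm _ _ p) all_cat.
have [adm|//] := boolP (admissible _ _ _ _).
by have [_ ale ble] := admissible_le adm; rewrite IHa ?IHb.
Qed.

Lemma perm_outer_inner x t : perm_eq (x :: tree_edges t) (outer x t ++ inner x t).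
Proof.
elim: t x => [|v a b ta IHa tb IHb] x //=.
apply/permP => P; have /permP/(_ P) := IHa a; have /permP/(_ P) := IHb b.
by rewrite /= !count_cat /= !count_cat; clear; lia.
Qed.

(** Every edge except the root has a half-edge at the node above it, and every inner edge has one at
    the node below it. The term [x == e] makes up for the missing upper end of the root. *)
Lemma tree_half_edges x t e : embedded x t ->
  \sum_(v <- tree_verts t) count_mem e (inc v) + (x == e) =
  count_mem e (x :: tree_edges t) + count_mem e (inner x t).
Proof.
elim: t x => [|v a b ta IHa tb IHb] x /=; first by rewrite big_nil; lia.
move=> /and3P[/permP p /IHa ha /IHb hb]; move: ha hb.
by rewrite big_cons big_cat /= p /= !count_cat; clear; lia.
Qed.

Lemma graft x t y v a b : embedded x t -> y \in outer x t ->
    perm_eq (inc v) [:: y; a; b] ->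
  exists t', [/\ embedded x t', perm_eq (tree_edges t') [:: a, b & tree_edges t]
    & perm_eq (tree_verts t') (v :: tree_verts t)].
Proof.
move=> et yt p; elim: t x et yt => [x _|v0 a0 b0 ta IHa tb IHb x].
  by rewrite /= inE => /eqP<-; exists (Node v a b Tip Tip); rewrite /= p.
move=> /and3P[p0 ea eb] /=; rewrite mem_cat => /orP[/(IHa _ ea)|/(IHb _ eb)] [t' [e' pe pv]].
  exists (Node v0 a0 b0 t' tb); split; [exact/and3P|apply/permP => P..].
    by have /permP/(_ P) := pe; rewrite /= !count_cat /=; clear; lia.
  by have /permP/(_ P) := pv; rewrite /= !count_cat /=; clear; lia.
exists (Node v0 a0 b0 ta t'); split; [exact/and3P|apply/permP => P..].
  by have /permP/(_ P) := pe; rewrite /= !count_cat /=; clear; lia.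
by have /permP/(_ P) := pv; rewrite /= !count_cat /=; clear; lia.
Qed.

Definition simple_walk u v (S : seq (edge G)) := exists s,
  [/\ walk u s v, uniq [seq i.1 | i <- s] & {subset [seq i.1 | i <- s] <= S}].

Lemma simple_walk_rev u v S : simple_walk u v S -> simple_walk v u S.
Proof.
move=> [s [/walk_rev[s' w p] un sub]]; exists s'; split=> //.
  by rewrite (perm_uniq p).
by move=> e; rewrite (perm_mem p) => /sub.
Qed.

Lemma simple_walk_cat u v v' S S' S2 : {subset S <= S2} -> {subset S' <= S2} ->
    (forall e, e \in S -> e \notin S') ->
  simple_walk u v S -> simple_walk v v' S' -> simple_walk u v' S2.
Proof.
move=> sS sS' dis [s [w un sub]] [s' [w' un' sub']].
exists (s ++ s'); rewrite map_cat; split; first exact: walk_cat w w'.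
  rewrite cat_uniq un un' andbT; apply/hasPn => e /sub' e'; apply/negP => /sub e0.
  by move: (dis _ e0); rewrite e'.
by move=> e; rewrite mem_cat => /orP[/sub/sS|/sub'/sS'].
Qed.

Lemma simple_walk_sub u v S S' : {subset S <= S'} -> simple_walk u v S -> simple_walk u v S'.
Proof. by move=> sub [s [w un ss]]; exists s; split=> // e /ss/sub. Qed.

Lemma simple_walk_edge e u v S : e \in S -> u != v -> e \in inc u -> e \in inc v ->
  simple_walk u v S.
Proof.
move=> eS uv eu ev; exists [:: (e, v)]; split=> //=; first by rewrite joins_neq //= eqxx.
by move=> e'; rewrite inE => /eqP->.
Qed.

Lemma inner_sub x t : {subset inner x t <= x :: tree_edges t}.
Proof. by move=> e ei; rewrite (perm_mem (perm_outer_inner x t)) mem_cat ei orbT. Qed.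

Lemma walk_down v a ta u : embedded a ta -> a \in inc v -> v \notin tree_verts ta ->
  uniq (tree_verts ta) -> uniq (a :: tree_edges ta) -> u \in tree_verts ta ->
  simple_walk v u (inner a ta).
Proof.
elim: ta v a => [//|va a1 b1 t1 IH1 t2 IH2] v a /and3P[p e1 e2] av.
rewrite inE negb_or => /andP[vva vt] /= /andP[vat]; rewrite cat_uniq.
move=> /and3P[u1 _ u2] /and4P[aed a1ed b1ed].
rewrite cat_uniq => /and3P[ue1 dis ue2].
have inner1 : {subset a1 :: tree_edges t1 <= [:: a1, b1 & tree_edges t1 ++ tree_edges t2]}.
  by move=> e; rewrite !inE mem_cat => /predU1P[->|->]; rewrite ?eqxx ?orbT.
have inner2 : {subset b1 :: tree_edges t2 <= [:: a1, b1 & tree_edges t1 ++ tree_edges t2]}.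
  by move=> e; rewrite !inE mem_cat => /predU1P[->|->]; rewrite ?eqxx ?orbT.
have step : simple_walk v va [:: a].
  by apply: (simple_walk_edge (mem_head _ _) vva av); rewrite (perm_mem p) mem_head.
move: vat; rewrite mem_cat negb_or => /andP[va1 va2].
rewrite inE mem_cat => /or3P[/eqP->|ut|ut].
- by apply: simple_walk_sub step => e; rewrite !inE => ->.
- apply: (simple_walk_cat _ _ _ step (IH1 va a1 e1 _ va1 u1 _ ut)).
  + by move=> e; rewrite !inE => ->.
  + by move=> e ei; rewrite inE mem_cat ei orbT.
  + move=> e; rewrite inE => /eqP->; apply: contra aed => /inner_sub; exact: inner1.
  + by rewrite (perm_mem p) !inE eqxx orbT.
  + rewrite /= ue1 andbT; apply: contra a1ed => a1t; by rewrite inE mem_cat a1t orbT.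
- apply: (simple_walk_cat _ _ _ step (IH2 va b1 e2 _ va2 u2 _ ut)).
  + by move=> e; rewrite !inE => ->.
  + by move=> e ei; rewrite inE mem_cat ei !orbT.
  + move=> e; rewrite inE => /eqP->; apply: contra aed => /inner_sub; exact: inner2.
  + by rewrite (perm_mem p) !inE eqxx !orbT.
  + rewrite /= ue2 andbT; apply: contra b1ed => b1t; by rewrite mem_cat b1t orbT.
Qed.

(** Climb to the lowest common node and descend again; the two subtrees below it have disjoint
    edges. The walk serves to close a cycle in [grow_tree]. *)
Lemma walk_in_tree x t u u' : embedded x t -> uniq (tree_verts t) ->
    uniq (x :: tree_edges t) -> u \in tree_verts t -> u' \in tree_verts t ->
  simple_walk u u' (inner x t).
Proof.
elim: t x => [//|v a b ta IHa tb IHb] x /= /and3P[p ea eb] /andP[vt].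
rewrite cat_uniq => /and3P[va _ vb] /and4P[xed aed bed].
rewrite cat_uniq => /and3P[uea dis ueb].
move: vt; rewrite mem_cat negb_or => /andP[vta vtb].
have ua : uniq (a :: tree_edges ta).
  by rewrite /= uea andbT; apply: contra aed => aa; rewrite inE mem_cat aa orbT.
have ub : uniq (b :: tree_edges tb).
  by rewrite /= ueb andbT; apply: contra bed => bb; rewrite mem_cat bb orbT.
have av : a \in inc v by rewrite (perm_mem p) !inE eqxx orbT.
have bv : b \in inc v by rewrite (perm_mem p) !inE eqxx !orbT.
have suba : {subset inner a ta <= x :: inner a ta ++ inner b tb}.
  by move=> e ei; rewrite inE mem_cat ei orbT.
have subb : {subset inner b tb <= x :: inner a ta ++ inner b tb}.
  by move=> e ei; rewrite inE mem_cat ei !orbT.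
have disj e : e \in inner a ta -> e \notin inner b tb.
  move=> /inner_sub eta; apply/negP => /inner_sub.
  move: eta; rewrite !inE => /predU1P[->|eta] /predU1P[eb'|etb].
  - by move: aed; rewrite eb' inE eqxx.
  - by move: aed; rewrite inE mem_cat etb !orbT.
  - by move: bed; rewrite -eb' mem_cat eta.
  - by case/hasP: dis; exists e.
have down1 u1 : u1 \in tree_verts ta -> simple_walk v u1 (inner a ta).
  exact: walk_down.
have down2 u1 : u1 \in tree_verts tb -> simple_walk v u1 (inner b tb).
  exact: walk_down.
rewrite !inE !mem_cat => /or3P[/eqP->|uta|utb] /or3P[/eqP->|uta'|utb'].
- by exists [::]; split=> //=.
- exact: simple_walk_sub suba (down1 _ _).
- exact: simple_walk_sub subb (down2 _ _).
- exact: simple_walk_sub suba (simple_walk_rev (down1 _ _)).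
- exact: simple_walk_sub suba (IHa _ _ _ _ _ _).
- exact: simple_walk_cat suba subb disj (simple_walk_rev (down1 _ _)) (down2 _ _).
- exact: simple_walk_sub subb (simple_walk_rev (down2 _ _)).
- apply: simple_walk_cat subb suba _ (simple_walk_rev (down2 _ _)) (down1 _ _) => // e e2.
  by apply/negP => /disj; rewrite e2.
- exact: simple_walk_sub subb (IHb _ _ _ _ _ _).
Qed.

End EmbeddedTrees.

Section TrivalentTrees.
Variables (G : trigraph) (l : edge G).
Implicit Types (t : btree (vertex G) (edge G)) (e y : edge G) (u v : vertex G).
Hypotheses (half1 : is_leaf l) (half2 : forall e, 0 < half_edges e <= 2).
Hypotheses (conG : connected_graph G) (acG : acyclic_graph G).

Let tree_ok t := [&& embedded l t, uniq (l :: tree_edges t) & uniq (tree_verts t)].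

Lemma half_edges_leaf e : e = l -> half_edges e = 1.
Proof. by move=> ->; exact/eqP. Qed.

Lemma inc_edges t v e : embedded l t -> v \in tree_verts t -> e \in inc v ->
  e \in l :: tree_edges t.
Proof.
move=> et vt ev; have := tree_half_edges e et.
rewrite (perm_big _ (perm_to_rem vt)) big_cons.
have : 0 < count_mem e (inc v) by rewrite -has_count has_pred1.
have [//|/negP no] := boolP (e \in l :: tree_edges t).
have -> : count_mem e (l :: tree_edges t) = 0 by apply: count_memPn; exact/negP.
have -> : count_mem e (inner l t) = 0.
  by apply: count_memPn; apply/negP => /inner_sub.
by case: (count_mem e (inc v)).
Qed.

Lemma count_outer_inner t e : tree_ok t -> e \in l :: tree_edges t ->
  count_mem e (l :: tree_edges t) = 1 /\ count_mem e (inner l t) = (e \notin outer l t).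
Proof.
move=> /and3P[_ ut _] et; have p := perm_outer_inner l t.
have ui : uniq (outer l t ++ inner l t) by rewrite -(perm_uniq p).
rewrite count_uniq_mem // et; split=> //.
move: ui; rewrite cat_uniq => /and3P[_ dis ui]; rewrite count_uniq_mem //.
move: et; rewrite (perm_mem p) mem_cat; have [eo _|_ /= ->//] := boolP (e \in outer l t).
by apply/eqP; rewrite eqb0; apply: contra dis => ei; apply/hasP; exists e.
Qed.

(** The half-edges of [e] at the nodes of the tree, counted by [tree_half_edges], are different from
    those at the new vertex [v]. *)
Lemma half_edges_new t e v : tree_ok t -> e \in l :: tree_edges t -> v \notin tree_verts t ->
  1 + (e \notin outer l t) + count_mem e (inc v) <= half_edges e + (l == e).
Proof.
move=> ok et vt; have [ec ei] := count_outer_inner ok et; have /and3P[em _ uv] := ok.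
have := tree_half_edges e em; rewrite ec ei => <-.
have := @half_edges_seq _ e (v :: tree_verts t); rewrite /= vt uv big_cons => /(_ isT) le.
lia.
Qed.

Lemma root_outer t : tree_ok t -> l \in outer l t -> t = Tip.
Proof.
case: t => [//|v a b ta tb] /and3P[_ /= /andP[lt _] _] lo; case/negP: lt.
have sub x t0 : {subset outer x t0 <= x :: tree_edges t0}.
  by move=> e eo; rewrite (perm_mem (perm_outer_inner x t0)) mem_cat eo.
move: lo; rewrite !inE !mem_cat => /orP[/sub|/sub]; rewrite inE => /orP[]->;
by rewrite ?orbT.
Qed.

(** The two other half-edges at [v] lie on edges new to the tree: an edge already present would have
    too many half-edges, or would close a cycle together with [y]. So [v] can be grafted at [y]. *)
Lemma grow_tree t y v : tree_ok t -> y \in outer l t -> v \notin tree_verts t ->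
    y \in inc v ->
  exists2 t', tree_ok t' & size (tree_verts t') = (size (tree_verts t)).+1.
Proof.
move=> ok yo vt yv; have /and3P[em ut uv] := ok.
have [a [b p]] : exists a b, perm_eq (inc v) [:: y; a; b].
  have := perm_to_rem yv; have := size_rem yv; rewrite size_tuple.
  by case: (rem y (inc v)) => [|a [|b []]] // _ p; exists a, b.
have yt : y \in l :: tree_edges t by rewrite (perm_mem (perm_outer_inner l t)) mem_cat yo.
have fresh e c : perm_eq (inc v) [:: y; e; c] -> e \notin l :: tree_edges t.
  move=> pe; apply/negP => et; have := half_edges_new ok et vt.
  have /permP/(_ (pred1 e)) /= -> := pe; rewrite eqxx.
  have /andP[_ h2] := half2 e.
  have [tTip|tN] := boolP (l \in outer l t).
    have tT := root_outer ok tTip; move: yo et; rewrite tT /= !inE => /eqP-> /eqP->.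
    by rewrite half_edges_leaf // eqxx.
  have yl : y != l by apply: contraNneq tN => yl; rewrite yl in yo.
  have [le|nle] := eqVneq l e.
    by rewrite half_edges_leaf // -le tN; clear; lia.
  have [eo|_] := boolP (e \in outer l t); last by move: h2; clear; lia.
  have [_|nye _] := eqVneq y e; first by move: h2; clear; lia.
  (* The remaining case: [e] is an outer edge other than [y]. Then [e], a walk inside the tree and
     [y] form a cycle through [v]. *)
  have far z : z \in outer l t -> l != z -> exists2 u, u \in tree_verts t & z \in inc u.
    move=> zo lz; have zt : z \in l :: tree_edges t.
      by rewrite (perm_mem (perm_outer_inner l t)) mem_cat zo.
    have := tree_half_edges z em; rewrite (negPf lz) addn0.
    have [-> _] := count_outer_inner ok zt => s0.
    have [/hasP[u ut' zu]|/hasPn no] := boolP (has (fun u => z \in inc u) (tree_verts t)).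
      by exists u.
    move: s0; rewrite big_seq big1 // => u /no ?; exact/count_memPn.
  have ly : l != y by rewrite eq_sym.
  have [u uvt yu] := far y yo ly.
  have [u' uvt' eu'] := far e eo nle.
  have [s [w un sub]] := walk_in_tree em uv ut uvt' uvt.
  have ninner z : z \in outer l t -> z \notin [seq i.1 | i <- s].
    move=> zo; apply/negP => /sub zi.
    have := perm_uniq (perm_outer_inner l t); rewrite ut cat_uniq => /esym/and3P[_ /hasP[]].
    by exists z.
  have ev : e \in inc v by rewrite (perm_mem pe) !inE eqxx orbT.
  have neq z : z \in tree_verts t -> v != z by move=> zt; apply: contraNneq vt => ->.
  suff: (e, u') :: s ++ [:: (y, v)] = [::] by [].
  apply: (@acG v); first by rewrite /= joins_neq ?neq //= (walk_cat w) //=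
    joins_neq ?eqxx // eq_sym neq.
  rewrite /= map_cat mem_cat /= inE negb_or ninner //= eq_sym nye cat_uniq un /= orbF andbT.
  exact: ninner.
have pb : perm_eq (inc v) [:: y; b; a].
  by apply: (perm_trans p); rewrite perm_cons; apply/permP => P /=; rewrite !addn0 addnC.
(* Otherwise [a] is a loop at [v]. *)
have ab : a != b.
  apply/eqP => ab; suff: [:: (a, v)] = [::] by [].
  apply: (@acG v) => //=; rewrite eqxx andbT.
  by rewrite /joins eqxx; have /permP/(_ (pred1 a)) /= -> := p; rewrite -ab eqxx; case: eqP.
have [t' [et' pe' pv']] := graft em yo p.
exists t'; last by rewrite (perm_size pv').
rewrite /tree_ok et' (perm_uniq pv') /= vt uv /= andbT (perm_mem pe') (perm_uniq pe').
have := fresh _ _ p; have := fresh _ _ pb; move: ut => /= /andP[lt ut].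
rewrite !inE !negb_or => /andP[bl bt] /andP[al at'].
by rewrite eq_sym al eq_sym bl lt ab at' bt ut.
Qed.

Definition saturated t := forall y v, y \in outer l t -> y \in inc v -> v \in tree_verts t.

(** Each growth step adds a vertex, so the number of vertices bounds the process. *)
Lemma saturated_tree : exists2 t, tree_ok t & saturated t.
Proof.
have grow n : (exists2 t, tree_ok t & saturated t) \/
    exists2 t, tree_ok t & size (tree_verts t) = n.
  elim: n => [|n [IH|[t ok sz]]]; [by right; exists Tip|by left|].
  have [/existsP[y /existsP[v /and3P[yo vt yv]]]|no] := boolP [exists y, exists v,
      [&& y \in outer l t, v \notin tree_verts t & y \in inc v]].
    by right; have [t' ok' sz'] := grow_tree ok yo vt yv; exists t'; rewrite ?sz' ?sz.
  left; exists t => // y v yo yv; apply: contraR no => vt.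
  by apply/existsP; exists y; apply/existsP; exists v; rewrite yo vt.
have [//|[t /and3P[_ _ uv] sz]] := grow #|vertex G|.+1.
by have := max_card (mem (tree_verts t)); rewrite (card_uniqP uv) sz ltnn.
Qed.

(** No edge leaves a saturated tree: outer edges by saturation, the others because their half-edges
    are used up. Connectedness then yields all vertices, and with them all edges. *)
Lemma tree_btree : exists t, [/\ embedded l t, uniq (l :: tree_edges t),
  forall v, v \in tree_verts t, forall e, e \in l :: tree_edges t & t <> Tip].
Proof.
have [t ok sat] := saturated_tree; have /and3P[em ut uv] := ok.
have [v0 lv0] : exists v, l \in inc v by apply: mem_half_edges; rewrite half_edges_leaf.
have tN : t <> Tip by move=> tT; have := sat l v0; rewrite tT /= mem_head => /(_ isT lv0).
have lo : l \notin outer l t by apply/negP => /(root_outer ok).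
have step e u v : u \in tree_verts t -> e \in inc u -> e \in inc v -> v \in tree_verts t.
  move=> ut' eu ev; apply: contraT => vt; have et := inc_edges em ut' eu.
  have [eo|ei] := boolP (e \in outer l t); first by rewrite (sat e v eo ev) in vt.
  have := half_edges_new ok et vt; rewrite ei.
  have : 0 < count_mem e (inc v) by rewrite -has_count has_pred1.
  have /andP[_ h2] := half2 e.
  have [le|_] := eqVneq l e; first by rewrite half_edges_leaf //; clear; lia.
  by move: h2; clear; lia.
have allv v : v \in tree_verts t.
  have [u0 u0t] : exists u, u \in tree_verts t.
    by case: (t) tN => [//|u a b ta tb] _; exists u; rewrite mem_head.
  have [s] := conG u0 v; elim: s u0 u0t => [u0 u0t /eqP<- //|[e u1] s IH u0 u0t /=].
  by move=> /andP[/joins_mem[e0 e1]]; apply: IH; exact: step u0t e0 e1.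
exists t; split=> // e; have /andP[/mem_half_edges[v ev] _] := half2 e.
exact: inc_edges em (allv v) ev.
Qed.

End TrivalentTrees.

(** * The graphs Gamma(g, n) *)

Lemma polytope_forall (G : trigraph) L (w : {ffun edge G -> nat}) :
  polytope false L w = [forall v, admissible_at L w v].
Proof. by rewrite /polytope /= andbT. Qed.

Lemma polytope_tree (G : trigraph) (l : edge G) (t : btree (vertex G) (edge G)) L
    (w : {ffun edge G -> nat}) :
  embedded l t -> (forall v, v \in tree_verts t) -> t <> Tip ->
  polytope false L w = tree_wt t L (w l) w.
Proof.
move=> em allv tN.
have -> : polytope false L w = all (admissible_at L w) (tree_verts t).
  rewrite polytope_forall; apply/forallP/allP => adm v; first by move=> _; exact: adm.
  exact: adm (allv v).
have [le|nle] := leqP (w l) L; first by rewrite tree_wt_embedded.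
(* A root weight above the level violates admissibility at the first node, which exists as [t] is
   not a bare tip. *)
transitivity false; last by apply/esym/negP => /tree_wt_le; rewrite leqNgt nle.
move: em tN; case: (t) => [//|v a b ta tb] /and3P[p _ _] _ /=.
rewrite (admissible_at_perm _ _ p); apply/negP => /andP[/admissible_le[]].
by rewrite leqNgt nle.
Qed.

Section ChainParts.
Variables (A B : Type) (E F : finType) (f : E -> F).
Implicit Types (s : seq (E * E * E)) (t : btree A E) (w : {ffun E -> nat}).

Lemma chain_edges_cat s t : chain_edges s t = chain_edges s (@Tip B E) ++ tree_edges t.
Proof. by elim: s => [//|[[y z] x] s IH] /=; rewrite IH. Qed.

Lemma chain_layout_cat s t : chain_layout s (@Tip B E) -> uniq (tree_edges t) ->
    (forall e, e \in chain_edges s (@Tip B E) -> e \notin tree_edges t) ->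
  chain_layout s t.
Proof.
move=> + ut; elim: s => [//|[[y z] x] s IH] /= /and5P[xyz yt zt xt lay] dis.
rewrite !chain_edges_cat xyz !mem_cat !negb_or yt zt xt !dis ?inE ?eqxx ?orbT //=.
by apply: IH => // e es; apply: dis; rewrite !inE es !orbT.
Qed.

Definition last_link s (x0 : E) : E := last x0 [seq b.2 | b <- s].

(** The tip closing the chain bounds the last link by [L], and so does the tree hanging there. *)
Lemma chain_wt_cat s t L p x w : s <> [::] ->
  chain_wt s t L p w =
  chain_wt s (@Tip B E) L p w && tree_wt t L (w (last_link s x)) w.
Proof.
case: s => [//|[[y z] x'] s] _ /=; rewrite -andbA; congr (_ && _).
rewrite /last_link /=; elim: s x' => [|[[? ?] x''] s IH] x' /=; last by rewrite IH andbA.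
by have [/tree_wt_le ->|_] := boolP (tree_wt _ _ _ _); rewrite ?andbF.
Qed.

Definition map_blob (b : E * E * E) : F * F * F := (f b.1.1, f b.1.2, f b.2).

Fixpoint map_tree t : btree A F :=
  if t is Node v a b ta tb then Node v (f a) (f b) (map_tree ta) (map_tree tb) else Tip.

Lemma map_tree_edges t : tree_edges (map_tree t) = map f (tree_edges t).
Proof. by elim: t => //= v a b ta -> tb ->; rewrite map_cat. Qed.

Lemma map_tree_wt t L p (w : {ffun F -> nat}) :
  tree_wt (map_tree t) L p w = tree_wt t L p [ffun e => w (f e)].
Proof. by elim: t p => //= v a b ta IHa tb IHb p; rewrite IHa IHb !ffunE. Qed.

Lemma map_chain_edges s t :
  chain_edges (map map_blob s) (map_tree t) = map f (chain_edges s t).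
Proof. by elim: s => [|[[y z] x] s IH] /=; rewrite ?map_tree_edges ?IH. Qed.

Lemma map_chain_wt s t L p (w : {ffun F -> nat}) :
  chain_wt (map map_blob s) (map_tree t) L p w = chain_wt s t L p [ffun e => w (f e)].
Proof.
by elim: s p => [|[[y z] x] s IH] p /=; rewrite ?map_tree_wt // IH !ffunE.
Qed.

Lemma map_chain_layout s t : injective f ->
  chain_layout (map map_blob s) (map_tree t) = chain_layout s t.
Proof.
move=> fI; elim: s => [|[[y z] x] s IH] /=; first by rewrite map_tree_edges map_inj_uniq.
by rewrite IH !map_chain_edges !mem_map // !(inj_eq fI).
Qed.

End ChainParts.

Lemma last_map_blob (E F : finType) (f : E -> F) s x :
  last_link (map (map_blob f) s) (f x) = f (last_link s x).
Proof. by rewrite /last_link; elim: s x => //= b s IH x; exact: IH. Qed.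

Section ChainGraph.
Variables (h : nat) (A : Type).
Implicit Types (i : 'I_h) (r : seq 'I_h) (w : {ffun chain_edge h -> nat}).

Definition blob_edges i : chain_edge h * chain_edge h * chain_edge h :=
  (chain_para i false, chain_para i true, chain_link (lift ord0 i)).

Definition chain_blobs : seq (chain_edge h * chain_edge h * chain_edge h) :=
  (None, None, chain_link ord0) :: map blob_edges (enum 'I_h).

Let tip := @Tip A (chain_edge h).

(** The position along the chain grows from blob to blob, which shows that different blobs share no
    edge. *)
Definition edge_pos (e : chain_edge h) : nat :=
  match e with
  | None => 0
  | Some (inl j) => j
  | Some (inr (i, _)) => i.+1
  end.

Lemma blob_edges_pos r m e : [seq val i | i <- r] = iota m (size r) ->
  e \in chain_edges (map blob_edges r) tip -> m < edge_pos e.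
Proof.
elim: r m => [//|i r IH] m /= [im /IH{}IH]; rewrite !inE.
case/or4P => [/eqP->|/eqP->|/eqP->|/IH/ltnW //]; by rewrite /= ?im.
Qed.

Lemma blob_edges_layout r m : [seq val i | i <- r] = iota m (size r) ->
  chain_layout (map blob_edges r) tip.
Proof.
elim: r m => [//|i r IH] m /= [im vr]; rewrite (IH _ vr).
have pos e : edge_pos e = m.+1 -> e \notin chain_edges [seq blob_edges j | j <- r] tip.
  by move=> em; apply/negP => /(blob_edges_pos vr); rewrite em ltnn.
by rewrite !pos //= ?im // /bump /= add1n im.
Qed.

Lemma chain_blobs_layout : chain_layout chain_blobs tip.
Proof.
have vr : [seq val i | i <- enum 'I_h] = iota 0 (size (enum 'I_h)).
  by rewrite val_enum_ord size_enum_ord.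
rewrite /= (blob_edges_layout vr).
have pos e : edge_pos e = 0 -> e \notin chain_edges [seq blob_edges j | j <- enum 'I_h] tip.
  by move=> em; apply/negP => /(blob_edges_pos vr); rewrite em.
by rewrite !pos.
Qed.

Lemma chain_blobs_cover e : e \in chain_edges chain_blobs tip.
Proof.
have mem i r : i \in r -> [/\ chain_para i false \in chain_edges (map blob_edges r) tip,
    chain_para i true \in chain_edges (map blob_edges r) tip
  & chain_link (lift ord0 i) \in chain_edges (map blob_edges r) tip].
  elim: r => [//|j r IH]; rewrite inE => /predU1P[->|/IH[m1 m2 m3]].
    by rewrite /= !inE !eqxx !orbT.
  by rewrite /= !inE m1 m2 m3 !orbT.
case: e => [[j|[i b]]|]; rewrite /= !inE //.
  by case: (unliftP ord0 j) => [i|] ->; rewrite ?eqxx //;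
    have [_ _ ->] := mem i _ (mem_enum _ i); rewrite ?orbT.
by have [m1 m2 _] := mem i (enum 'I_h) (mem_enum _ _); case: b; rewrite ?m1 ?m2 !orbT.
Qed.

Lemma last_chain_blobs x : last_link chain_blobs x = chain_leaf h.
Proof.
rewrite /last_link /= -map_comp /chain_leaf.
suff last_blob r (j : 'I_h.+1) : [seq val i | i <- r] = iota j (size r) -> j + size r = h ->
    last (chain_link j) [seq (blob_edges i).2 | i <- r] = chain_link ord_max.
  by apply: last_blob; rewrite ?val_enum_ord size_enum_ord.
elim: r j => [|i r IH] j /=.
  by move=> _; rewrite addn0 => jh; congr chain_link; exact: val_inj.
by move=> [ij vr] jr; apply: IH; rewrite /= /bump /= add1n ij // addSnnS.
Qed.

Lemma blob_edges_wt r (j : 'I_h.+1) L w : [seq val i | i <- r] = iota j (size r) ->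
    w (chain_link j) <= L ->
  chain_wt (map blob_edges r) tip L (w (chain_link j)) w =
  all (fun i => admissible_at (G := chain h) L w (Some (i, false)) &&
                admissible_at (G := chain h) L w (Some (i, true))) r.
Proof.
elim: r j => [//|i r IH] j /= [ij vr] jL.
have -> : admissible_at (G := chain h) L w (Some (i, false)) =
    admissible L (w (chain_link j)) (w (chain_para i false)) (w (chain_para i true)).
  rewrite (_ : j = widen_ord (leqnSn h) i); last exact: val_inj.
  by apply: admissible_at_perm; exact: perm_refl.
have -> : admissible_at (G := chain h) L w (Some (i, true)) =
    admissible L (w (chain_para i false)) (w (chain_para i true)) (w (chain_link (lift ord0 i))).
  by apply: admissible_at_perm; exact: perm_refl.
rewrite -/(blob_wt _ _ _ _ _).
have [/andP[_ /admissible_le[_ _ le]] /=|//] := boolP (blob_wt _ _ _ _ _).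
by apply: IH => //=; rewrite /bump /= add1n ij.
Qed.

Lemma polytope_chain L w :
  polytope (G := chain h) false L w = chain_wt chain_blobs tip L 0 w.
Proof.
rewrite polytope_forall /=.
have vr : [seq val i | i <- enum 'I_h] = iota (@ord0 h) (size (enum 'I_h)).
  by rewrite val_enum_ord size_enum_ord.
(* The loop vertex as a blob with incoming weight 0: the extra triple 0, a, a only asks for a at
   most [L], which the vertex condition implies. *)
have adm0 : admissible_at (G := chain h) L w None =
    blob_wt L 0 (w None) (w None) (w (chain_link ord0)).
  have -> : admissible_at (G := chain h) L w None =
      admissible L (w None) (w None) (w (chain_link ord0)).
    by apply: admissible_at_perm; exact: perm_refl.
  by rewrite /blob_wt /admissible; apply/idP/idP; lia.
rewrite -adm0.
have [a0|n0] /= := boolP (admissible_at (G := chain h) L w None); last first.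
  by apply/negbTE/forallPn; exists None.
rewrite (blob_edges_wt vr); last first.
  by move: a0; rewrite adm0 => /andP[_ /admissible_le[]].
apply/forallP/allP => [adm i _|adm [[i b]|//]]; first by rewrite !adm.
by have /andP[] := adm i (mem_enum _ _); case: b.
Qed.

End ChainGraph.

Section GlueGraph.
Variables (G1 G2 : trigraph) (e1 : edge G1) (e2 : edge G2).
Let f1 : edge G1 -> edge (glue e1 e2) := inl.
Let f2 : edge G2 -> edge (glue e1 e2) := @glue_edge2 G1 G2 e1 e2.

Lemma glue_edge2_root : f2 e2 = f1 e1.
Proof. by rewrite /f2 /glue_edge2 insubF // eqxx. Qed.

Lemma glue_edge2_off e : e != e2 -> exists e', f2 e = inr e' /\ val e' = e.
Proof. by move=> ne; exists (Sub e ne); rewrite /f2 /glue_edge2 insubT. Qed.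

Lemma glue_edge2_inj : injective f2.
Proof.
move=> e e'; have [->|/glue_edge2_off[y [-> <-]]] := eqVneq e e2;
  have [->|/glue_edge2_off[y' [-> <-]]] := eqVneq e' e2; rewrite ?glue_edge2_root //.
by move=> [->].
Qed.

Lemma polytope_glue L (w : {ffun edge (glue e1 e2) -> nat}) :
  polytope false L w = polytope false L ([ffun e => w (f1 e)] : {ffun edge G1 -> nat}) &&
                       polytope false L ([ffun e => w (f2 e)] : {ffun edge G2 -> nat}).
Proof.
have seq3 (E : eqType) (s : 3.-tuple E) : exists x y z, s = [:: x; y; z] :> seq E.
  by case: s => [[|x [|y [|z [|? ?]]]] sz] //; exists x, y, z.
have adm1 v : admissible_at L w (inl v) =
    admissible_at L ([ffun e => w (f1 e)] : {ffun edge G1 -> nat}) v.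
  have [x [y [z vE]]] := seq3 _ (inc v).
  rewrite (@admissible_at_perm G1 _ _ _ x y z) ?vE // !ffunE.
  by apply: admissible_at_perm; rewrite /= vE.
have adm2 v : admissible_at L w (inr v) =
    admissible_at L ([ffun e => w (f2 e)] : {ffun edge G2 -> nat}) v.
  have [x [y [z vE]]] := seq3 _ (inc v).
  rewrite (@admissible_at_perm G2 _ _ _ x y z) ?vE // !ffunE.
  by apply: admissible_at_perm; rewrite /= vE.
rewrite !polytope_forall; apply/forallP/andP => [adm|[/forallP a1 /forallP a2] [v|v]].
- by split; apply/forallP => v; rewrite -?adm1 -?adm2; exact: adm.
- by rewrite adm1.
- by rewrite adm2.
Qed.

End GlueGraph.

(** In genus 0 the tree is rooted at its leaf [l n]. In positive genus the graph is the chain closed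
    by a tip when [n <= 1], and otherwise the chain followed by the tree with [n.+1] leaves, rooted
    at the glued edge. *)
Lemma Gamma_decomposable (T : nat -> trigraph) (l : forall n, edge (T n)) (g n : nat) :
    (forall n, 3 <= n -> trivalent_tree (T n) n /\ is_leaf (l n)) -> 2 < 2 * g + n ->
  decomposable (@polytope (Gamma l g n) false).
Proof.
move=> hT; have tree m : 3 <= m -> exists t : btree (vertex (T m)) (edge (T m)),
    [/\ embedded (l m) t, uniq (l m :: tree_edges t),
      forall v, v \in tree_verts t, forall e, e \in l m :: tree_edges t & t <> Tip].
  by move=> /hT[[half con ac _] leaf]; exact: tree_btree leaf half con ac.
case: g => [|h] /= hgn.
  have [t [em ut allv alle tN]] := tree n hgn.
  by apply: (rooted_tree_decomposable ut alle) => L w; exact: polytope_tree.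
case: leqP => n1.
  apply: (@chain_decomposable unit _ (chain_blobs h) Tip).
  - exact: chain_blobs_layout.
  - exact: chain_blobs_cover.
  - exact: polytope_chain.
have [t [em ut allv alle tN]] := tree n.+1 n1.
pose f1 : edge (chain h) -> edge (glue (chain_leaf h) (l n.+1)) := inl.
pose f2 : edge (T n.+1) -> edge (glue (chain_leaf h) (l n.+1)) :=
  @glue_edge2 _ _ (chain_leaf h) (l n.+1).
have [lt ute] := andP ut.
have f2P e : e \in tree_edges t -> exists e', f2 e = inr e' /\ val e' = e.
  by move=> et; apply: glue_edge2_off; apply: contraNneq lt => <-.
apply: (@chain_decomposable _ _ (map (map_blob f1) (chain_blobs h)) (map_tree f2 t)).
- apply: (@chain_layout_cat _ unit).
  + by rewrite (@map_chain_layout unit _ _ f1 _ Tip) ?chain_blobs_layout //; move=> x y [].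
  + by rewrite map_tree_edges map_inj_uniq //; exact: glue_edge2_inj.
  + move=> e; rewrite (@map_chain_edges unit _ _ f1 _ Tip) => /mapP[e0 _ ->].
    by rewrite map_tree_edges; apply/negP => /mapP[e' /f2P[y [-> _]]].
- move=> e; rewrite (@chain_edges_cat _ unit) mem_cat (@map_chain_edges unit _ _ f1 _ Tip).
  rewrite map_tree_edges; case: e => [e|[e ne]].
    by apply/orP; left; apply: map_f; exact: chain_blobs_cover.
  apply/orP; right; apply/mapP; exists e.
    by have := alle e; rewrite inE (negPf ne).
  by rewrite /f2 /glue_edge2 insubT.
- move=> L w; rewrite polytope_glue (@polytope_chain h unit) (polytope_tree _ _ em allv tN).
  rewrite (@chain_wt_cat _ unit _ _ _ _ _ (f1 (chain_leaf h))) //.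
  rewrite (@map_chain_wt unit _ _ f1 _ Tip) map_tree_wt last_map_blob last_chain_blobs ffunE.
  by have -> : f1 (chain_leaf h) = f2 (l n.+1) by rewrite /f2 glue_edge2_root.
Qed.

(** * The semigroup algebra *)

Section Ideals.
Local Open Scope ring_scope.
Variables (A : comNzRingType) (X : A -> Prop).

Lemma in_ideal_gen_mem p : X p -> in_ideal_gen X p.
Proof.
move=> Xp; exists [:: (1, p)]; rewrite big_seq1 mul1r; split=> // q.
by rewrite inE => /eqP->.
Qed.

Lemma in_ideal_gen0 : in_ideal_gen X 0.
Proof. by exists [::]; rewrite big_nil. Qed.

Lemma in_ideal_genD p q : in_ideal_gen X p -> in_ideal_gen X q -> in_ideal_gen X (p + q).
Proof.
move=> [s [sX ->]] [s' [sX' ->]]; exists (s ++ s'); rewrite big_cat; split=> // z.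
by rewrite mem_cat => /orP[/sX|/sX'].
Qed.

Lemma in_ideal_genM a p : in_ideal_gen X p -> in_ideal_gen X (a * p).
Proof.
move=> [s [sX ->]]; exists [seq (a * q.1, q.2) | q <- s]; split.
  by move=> z /mapP[q /sX Xq ->].
by rewrite big_map mulr_sumr; apply: eq_bigr => q _ /=; rewrite mulrA.
Qed.

Lemma in_ideal_gen_sum (K : Type) (s : seq K) (F : K -> A) :
  (forall k, in_ideal_gen X (F k)) -> in_ideal_gen X (\sum_(k <- s) F k).
Proof.
move=> FX; elim: s => [|k s IH]; first by rewrite big_nil; exact: in_ideal_gen0.
by rewrite big_cons; exact: in_ideal_genD.
Qed.

Definition congruent p q := in_ideal_gen X (p - q).

Lemma congruent_refl p : congruent p p.
Proof. by rewrite /congruent subrr; exact: in_ideal_gen0. Qed.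

Lemma congruent_trans p q r : congruent p q -> congruent q r -> congruent p r.
Proof.
by move=> pq qr; rewrite /congruent -(subrKA q); exact: in_ideal_genD.
Qed.

Lemma congruent_sym p q : congruent p q -> congruent q p.
Proof. by move=> /(in_ideal_genM (-1)); rewrite mulN1r opprB. Qed.

Lemma congruentMl a p q : congruent p q -> congruent (a * p) (a * q).
Proof. by move=> /(in_ideal_genM a); rewrite mulrBr. Qed.

Lemma prodD2 (I : finType) (F : I -> A) k m : m != k ->
  \prod_i F i = \prod_(i | (i != k) && (i != m)) F i * (F k * F m).
Proof. by move=> mk; rewrite (bigD1 k) //= (bigD1 m) //= mulrA mulrC. Qed.

Section TwoProducts.
Variables (K : Type) (F H : K -> A).
Definition prod2 s t := \prod_(w <- s) F w * \prod_(w <- t) H w.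

Lemma prod2_cons x s t : prod2 (x :: s) t = F x * prod2 s t.
Proof. by rewrite /prod2 big_cons mulrA. Qed.

Lemma prod2_seq1 x s : prod2 s [:: x] = H x * prod2 s [::].
Proof. by rewrite /prod2 big_seq1 big_nil mulr1 mulrC. Qed.

Lemma congruent_merge x y z s : congruent (H x * H y) (F z) ->
  congruent (H x * prod2 s [:: y]) (prod2 (z :: s) [::]).
Proof.
by move=> c; rewrite prod2_cons prod2_seq1 mulrA mulrC [F z * _]mulrC; exact: congruentMl.
Qed.

End TwoProducts.

End Ideals.

Lemma malgC_monom (K : monomType) (C : comNzRingType) (c : C) (k : K) :
  (c%:MP * << k >> = << c *g k >> :> {malg C[K]})%R.
Proof. by rewrite malgM_def fgmulUU mulr1 mul1m. Qed.

Lemma monom_inj (K : choiceType) (C : comNzRingType) (k k' : K) :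
  (<< k >> = << k' >> :> {malg C[K]})%R -> k = k'.
Proof.
move=> /(congr1 (mcoeff k')); rewrite !mcoeffU eqxx.
by have [//|_ /esym/eqP] := eqVneq k k'; rewrite mulr1n mulr0n oner_eq0.
Qed.

Lemma monomM (K : monomType) (C : comNzRingType) (k k' : K) :
  (<< mmul k k' >> = << k >> * << k' >> :> {malg C[K]})%R.
Proof. by rewrite malgM_def fgmulUU mulr1. Qed.

Section Algebra.
Variables (C : comNzRingType) (G : trigraph) (closed : bool).
Local Notation B := (blocks G closed).
Local Notation M := {cmonom gen G closed}.
Local Notation S := (gen_poly C G closed).
Local Notation W := {ffun edge G -> nat}.
Local Notation phi := (@natural_map C G closed).
Local Notation mon_val := (@mon_val C G closed).
Implicit Types (x : gen G closed) (m : M) (r : seq (gen G closed)).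

Lemma mon_valE (d : {fset gen G closed}) m : (finsupp m `<=` d)%fset ->
  mon_val m = (\prod_(x <- d) (<< val x >> : {malg C[B]}) ^+ m x)%R.
Proof.
move=> le; rewrite /Defs.mon_val (big_fset_incl _ le) //= => x _ xm.
by rewrite memNfinsupp in xm; rewrite (eqP xm) expr0.
Qed.

Lemma mon_val_morphism : mmorphism mon_val.
Proof.
split=> [m1 m2|]; last by rewrite /Defs.mon_val mdom1 big_seq_fset0.
have le1 : (finsupp m1 `<=` finsupp (mmul m1 m2))%fset by rewrite mdomD fsubsetUl.
have le2 : (finsupp m2 `<=` finsupp (mmul m1 m2))%fset by rewrite mdomD fsubsetUr.
rewrite (mon_valE le1) (mon_valE le2) -big_split /=; apply: eq_bigr => x _.
by rewrite cmM exprD.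
Qed.

HB.instance Definition _ := isMultiplicative.Build M {malg C[B]} mon_val mon_val_morphism.

Lemma mon_valU x : mon_val (ucm x) = << val x >>%R.
Proof. by rewrite /Defs.mon_val mdomU big_seq_fset1 cmUU expr1. Qed.

Lemma mon_degE (d : {fset gen G closed}) m : (finsupp m `<=` d)%fset ->
  mon_deg m = \sum_(x <- d) m x * level (val x).
Proof.
move=> le; rewrite /mon_deg (big_fset_incl _ le) //= => x _ xm.
by rewrite memNfinsupp in xm; rewrite (eqP xm).
Qed.

Lemma mon_degM m1 m2 : mon_deg (mmul m1 m2) = mon_deg m1 + mon_deg m2.
Proof.
have le1 : (finsupp m1 `<=` finsupp (mmul m1 m2))%fset by rewrite mdomD fsubsetUl.
have le2 : (finsupp m2 `<=` finsupp (mmul m1 m2))%fset by rewrite mdomD fsubsetUr.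
rewrite (mon_degE le1) (mon_degE le2) -big_split /=; apply: eq_bigr => x _.
by rewrite cmM mulnDl.
Qed.

Lemma mon_degU x : mon_deg (ucm x) = level (val x).
Proof. by rewrite /mon_deg mdomU big_seq_fset1 cmUU mul1n. Qed.

Lemma phiM p q : phi (p * q)%R = (phi p * phi q)%R.
Proof. exact: (rmorphM (mmap (@malgC B C) mon_val)). Qed.

Lemma phiB p q : phi (p - q)%R = (phi p - phi q)%R.
Proof. exact: (raddfB (mmap (@malgC B C) mon_val)). Qed.

Lemma phi_sum (K : Type) (s : seq K) (F : K -> S) :
  phi (\sum_(k <- s) F k)%R = (\sum_(k <- s) phi (F k))%R.
Proof. exact: (raddf_sum (mmap (@malgC B C) mon_val)). Qed.

Lemma phiU (c : C) m : phi << c *g m >>%R = (c%:MP * mon_val m)%R.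
Proof. exact: mmapU. Qed.

End Algebra.

(** * Generation, and relations of degree at most 4 *)

Section Presentation.
Variables (C : comNzRingType) (G : trigraph) (closed : bool).
Hypothesis dec : decomposable (@polytope G false).
Local Notation B := (blocks G closed).
Local Notation M := {cmonom gen G closed}.
Local Notation S := (gen_poly C G closed).
Local Notation W := {ffun edge G -> nat}.
Local Notation phi := (@natural_map C G closed).
Local Notation mon_val := (@mon_val C G closed).
Local Notation mon m := (<< 1 *g m >>%R : S).
Implicit Types (x : gen G closed) (m : M) (r : seq (gen G closed)) (w : W).

Definition seq_mon r : M := \big[mmul/mone]_(x <- r) ucm x.
Definition seq_val r : B := \big[mmul/mone]_(x <- r) val x.

Lemma mon_val_seq r : mon_val (seq_mon r) = << seq_val r >>%R.
Proof.
rewrite /seq_mon /seq_val; elim: r => [|x r IH]; first by rewrite !big_nil mmorph1.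
by rewrite !big_cons mmorphM /= IH mon_valU monomM.
Qed.

Lemma seq_monP m : exists r, m = seq_mon r.
Proof.
have [k] := ubnP (mdeg m); elim: k m => // k IH m lek.
have [m0|/fset0Pn[x xm]] := eqVneq (finsupp m) fset0.
  exists [::]; rewrite /seq_mon big_nil; apply/eqP/cmP => i.
  by rewrite cm1; apply/eqP; rewrite -memNfinsupp m0 in_fset0.
have mE : m = mmul (ucm x) (divcm m (ucm x)).
  apply/eqP/cmP => i; rewrite cmM divcmE cmU subnKC //.
  by case: eqP => // <-; rewrite lt0n cmE_neq0.
have [|r rE] := IH (divcm m (ucm x)).
  by move: lek; rewrite {1}mE mdegM mdegU.
by exists (x :: r); rewrite /seq_mon big_cons -/(seq_mon r) -rE.
Qed.

Lemma polytope_closed L w : polytope closed L w =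
  polytope false L w && (closed ==> [forall e : edge G, is_leaf e ==> (w e == 0)]).
Proof. by rewrite /polytope /= andbT. Qed.

(** Weights are non-negative, so a leaf weight 0 forces 0 in every summand. This carries peeling and
    moves over to the closed case. *)
Lemma polytope_summand L1 L2 w1 w2 w : polytope false L1 w1 ->
    (forall e, w e = w1 e + w2 e) -> polytope closed L2 w -> polytope closed L1 w1.
Proof.
rewrite !polytope_closed => -> s /andP[_] /=; case: (closed) => //= /forallP z.
apply/forallP => e; apply/implyP => le; have := implyP (z e) le.
by rewrite s addn_eq0 => /andP[].
Qed.

Lemma level0_block (b : B) : level b = 0 -> b = mone.
Proof.
move=> L0; apply: val_inj; rewrite [val b]surjective_pairing -/(level b) L0.
congr pair; apply/ffunP => e; rewrite ffunE; apply: (decomposable0 dec).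
by have := valP b; rewrite polytope_closed -/(level b) L0 => /andP[].
Qed.

Lemma level_mul (b b' : B) : level (mmul b b') = level b + level b'.
Proof. by []. Qed.

(** Induction on the level: a summand of level 2 is peeled off while the level is at least 3; a
    generator or the unit remains. *)
Lemma seq_val_surj (b : B) : exists r, b = seq_val r.
Proof.
have [k] := ubnP (level b); elim: k b => // k IH b lek.
have [b0|bn] := posnP (level b).
  by exists [::]; rewrite /seq_val big_nil (level0_block b0).
have [b2|b2] := leqP (level b) 2.
  have b12 : (level b == 1) || (level b == 2) by move: bn b2; clear; lia.
  by exists [:: Sub b b12]; rewrite /seq_val big_seq1 SubK.
have [L Lb] : exists L, level b = L.+3 by exists (level b - 3); move: b2; clear; lia.
have vb := valP b; rewrite -/(level b) Lb in vb.
have vb' : polytope false L.+3 (val b).2 by move: vb; rewrite polytope_closed => /andP[].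
have [w [w' [pw pw' s]]] := decomposable_peel dec vb'.
have cw := polytope_summand pw s vb.
have cw' : polytope closed L.+1 w'.
  by apply: polytope_summand pw' _ vb => e; rewrite s addnC.
pose b1 : B := @Blocks G closed (2, w) cw; pose b2' : B := @Blocks G closed (L.+1, w') cw'.
have bE : b = mmul b1 b2'.
  apply: val_inj; rewrite [val b]surjective_pairing; congr pair; first exact: Lb.
  by apply/ffunP => e; rewrite ffunE s.
have [|r2 r2E] := IH b2'.
  by move: lek; rewrite bE level_mul /=; clear; rewrite /level /=; lia.
exists ((Sub b1 isT : gen G closed) :: r2).
by rewrite /seq_val big_cons SubK -/(seq_val r2) -r2E.
Qed.

Lemma phi_surj (Y : semigroup_alg C G closed) : exists p : S, phi p = Y.
Proof.
have ex (b : B) : exists m, mon_val m == << b >>%R.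
  by have [r ->] := seq_val_surj b; exists (seq_mon r); rewrite mon_val_seq.
pose rep b := xchoose (ex b).
exists (\sum_(b <- msupp Y) << Y@_b *g rep b >>)%R.
rewrite [RHS]monalgE phi_sum; apply: eq_bigr => b _.
by rewrite [LHS]phiU (eqP (xchooseP (ex b))) malgC_monom.
Qed.

(** The generating set used in the theorem: all homogeneous kernel elements of degree at most 4. *)
Definition low_relation (f : S) : Prop :=
  phi f = 0%R /\ exists d, d <= 4 /\ homogeneous d f.

Local Notation cong := (@congruent S low_relation).

Lemma mon_deg_seq r : mon_deg (seq_mon r) = level (seq_val r).
Proof.
rewrite /seq_mon /seq_val; elim: r => [|x r IH].
  by rewrite !big_nil /mon_deg mdom1 big_seq_fset0.
by rewrite !big_cons mon_degM mon_degU IH.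
Qed.

Lemma cong_seq4 r r' : level (seq_val r) <= 4 -> seq_val r = seq_val r' ->
  cong (mon (seq_mon r)) (mon (seq_mon r')).
Proof.
move=> d4 vv; apply: in_ideal_gen_mem; split.
  by rewrite phiB; apply/eqP; rewrite subr_eq0; apply/eqP;
    rewrite [LHS]phiU [RHS]phiU !mon_val_seq vv.
exists (level (seq_val r)); split=> // m0 /(fsubsetP (msuppB_le _ _)).
rewrite in_fsetU => /orP[]/(fsubsetP msuppU_le); rewrite in_fset1 => /eqP->.
  exact: mon_deg_seq.
by rewrite vv; exact: mon_deg_seq.
Qed.

Lemma mon_cons x r : mon (seq_mon (x :: r)) = (mon (ucm x) * mon (seq_mon r))%R.
Proof. by rewrite /seq_mon big_cons; exact: monomM. Qed.

Lemma mon_seq1 x : mon (seq_mon [:: x]) = mon (ucm x).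
Proof. by rewrite /seq_mon big_seq1. Qed.

Lemma seq_val1 x : seq_val [:: x] = val x.
Proof. by rewrite /seq_val big_seq1. Qed.

Lemma seq_val2 x1 x2 : seq_val [:: x1; x2] = mmul (val x1) (val x2).
Proof. by rewrite /seq_val big_cons big_seq1. Qed.

Lemma cong_mul22 x1 x2 y1 y2 : level (val x1) + level (val x2) <= 4 ->
    mmul (val x1) (val x2) = mmul (val y1) (val y2) ->
  cong (mon (ucm x1) * mon (ucm x2))%R (mon (ucm y1) * mon (ucm y2))%R.
Proof.
move=> d4 vv; have := @cong_seq4 [:: x1; x2] [:: y1; y2].
rewrite (mon_cons x1) (mon_cons y1) (mon_seq1 x2) (mon_seq1 y2) !seq_val2.
by apply.
Qed.

Lemma cong_mul21 x1 x2 y : level (val x1) + level (val x2) <= 4 ->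
    mmul (val x1) (val x2) = val y ->
  cong (mon (ucm x1) * mon (ucm x2))%R (mon (ucm y)).
Proof.
move=> d4 vv; have := @cong_seq4 [:: x1; x2] [:: y].
rewrite (mon_cons x1) (mon_seq1 x2) (mon_seq1 y) seq_val2 seq_val1.
by apply.
Qed.

Lemma cong_phi p q : cong p q -> phi p = phi q.
Proof.
move=> [s [sX pq]]; apply/eqP; rewrite -subr_eq0 -phiB pq phi_sum big_seq big1 // => z zs.
by rewrite phiM (proj1 (sX _ zs)) mulr0.
Qed.

(** The variable of the block [(L, w)], extended by 0 to pairs that are no generators, so that
    tables of bare weightings have monomials. *)
Definition genmon L w : S :=
  if (insub (L, w) : option B) is Some b then
    if (insub b : option (gen G closed)) is Some x then mon (ucm x) else 0%R
  else 0%R.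

Lemma genmonP L w : polytope closed L w -> 0 < L <= 2 ->
  exists2 x, val (val x) = (L, w) & genmon L w = mon (ucm x).
Proof.
move=> pw L12; pose b : B := @Blocks G closed (L, w) pw.
have b12 : (level b == 1) || (level b == 2) by rewrite /level /=; move: L12; clear; lia.
exists (Sub b b12); first by rewrite SubK.
rewrite /genmon (insubT (fun z => polytope closed z.1 z.2) (x := (L, w)) pw).
by rewrite (insubT (fun z : B => (level z == 1) || (level z == 2)) b12).
Qed.

Lemma genmon2_cong L1 L2 L1' L2' w1 w2 w1' w2' :
    0 < L1 <= 2 -> 0 < L2 <= 2 -> 0 < L1' <= 2 -> 0 < L2' <= 2 ->
    polytope closed L1 w1 -> polytope closed L2 w2 ->
    polytope closed L1' w1' -> polytope closed L2' w2' ->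
    L1 + L2 = L1' + L2' -> (forall e, w1 e + w2 e = w1' e + w2' e) ->
  cong (genmon L1 w1 * genmon L2 w2)%R (genmon L1' w1' * genmon L2' w2')%R.
Proof.
move=> l1 l2 l1' l2' p1 p2 p1' p2' ll ww.
have [x1 v1 ->] := genmonP p1 l1; have [x2 v2 ->] := genmonP p2 l2.
have [y1 u1 ->] := genmonP p1' l1'; have [y2 u2 ->] := genmonP p2' l2'.
apply: cong_mul22; first by rewrite /level v1 v2; move: l1 l2; clear => /=; lia.
apply: val_inj; rewrite /= v1 v2 u1 u2 /= ll; congr pair.
by apply/ffunP => e; rewrite !ffunE.
Qed.

Lemma genmon1_cong w1 w2 : polytope closed 1 w1 -> polytope closed 1 w2 ->
  cong (genmon 1 w1 * genmon 1 w2)%R (genmon 2 (add_wt w1 w2)).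
Proof.
move=> p1 p2; have [x1 v1 ->] := genmonP p1 isT; have [x2 v2 ->] := genmonP p2 isT.
have [y u ->] := genmonP (polytopeD p1 p2) isT.
apply: cong_mul21; first by rewrite /level v1 v2.
by apply: val_inj; rewrite /= v1 v2 u.
Qed.

Definition table_mon (I : finType) (l : I -> nat) (T : {ffun I -> W}) : S :=
  (\prod_k genmon (l k) (T k))%R.

(** A move changes two factors and keeps their product in the semigroup, which is a relation of
    degree at most 4 times the common other factors. The moves ignore the leaf condition, but the
    new rows are summands of a sum of old rows and so inherit it. *)
Lemma conn_cong (I : finType) (l : I -> nat) (T T' : {ffun I -> W}) :
    (forall k, 0 < l k <= 2) -> conn (fun k => polytope false (l k)) T T' ->
    (forall k, polytope closed (l k) (T k)) ->
  cong (table_mon l T) (table_mon l T').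
Proof.
move=> l12; elim=> [{}T {}T' -> _|{}T {}T' T1 [k [m [km off on]]] v1 _ IH pT].
  exact: congruent_refl.
have sum1 i j : i != j -> (forall e, T1 i e + T1 j e = T i e + T j e) ->
    polytope closed (l i) (T1 i).
  move=> ij s; apply: (polytope_summand (v1 i) _ (polytopeD (pT i) (pT j))) => e.
  by rewrite ffunE -s.
have mk : m != k by rewrite eq_sym.
have onC e : T1 m e + T1 k e = T m e + T k e by rewrite addnC on addnC.
have pT1 i : polytope closed (l i) (T1 i).
  have [->|ik] := eqVneq i k; first exact: sum1 km on.
  have [->|im] := eqVneq i m; first exact: sum1 mk onC.
  by rewrite off.
apply: congruent_trans (IH pT1); rewrite /table_mon.
have split_prod (U : {ffun I -> W}) : (\prod_i genmon (l i) (U i) =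
    (\prod_(i | (i != k) && (i != m)) genmon (l i) (U i)) *
    (genmon (l k) (U k) * genmon (l m) (U m)))%R.
  exact: (prodD2 (fun i => genmon (l i) (U i)) mk).
have rest : (\prod_(i | (i != k) && (i != m)) genmon (l i) (T i) =
    \prod_(i | (i != k) && (i != m)) genmon (l i) (T1 i))%R.
  by apply: eq_bigr => i /andP[ik im]; rewrite off.
rewrite (split_prod T) (split_prod T1) rest; apply: congruentMl.
by apply: genmon2_cong => // e; rewrite on.
Qed.

Lemma conn_same_sums_cong (I : finType) (l : I -> nat) (T T' : {ffun I -> W}) :
    (forall k, 0 < l k <= 2) -> (forall k, polytope closed (l k) (T k)) ->
    (forall k, polytope closed (l k) (T' k)) -> same_sums T T' ->
  cong (table_mon l T) (table_mon l T').
Proof.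
move=> l12 pT pT' sums; apply: conn_cong => //.
by apply: (decomposable_conn dec) => // k; [have := pT k|have := pT' k];
  rewrite polytope_closed => /andP[].
Qed.

Definition lists_mon (s2 s1 : seq W) : S := prod2 (genmon 2) (genmon 1) s2 s1.

(** A factor of level 1 is kept if it is the only one; otherwise a relation of degree 2 merges it
    with the one present into a factor of level 2. *)
Lemma normal_form r : exists s2 s1,
  [/\ all (polytope closed 2) s2, all (polytope closed 1) s1 /\ size s1 <= 1,
    cong (mon (seq_mon r)) (lists_mon s2 s1),
    level (seq_val r) = 2 * size s2 + size s1
  & forall e, (val (seq_val r)).2 e = \sum_(w <- s2) w e + \sum_(w <- s1) w e].
Proof.
elim: r => [|x r [s2 [s1 [p2 [p1 sz] cr lr wr]]]].
  exists [::], [::]; split=> //.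
  - by rewrite /lists_mon /prod2 /seq_mon !big_nil mulr1; exact: congruent_refl.
  - by rewrite /seq_val big_nil.
  - by move=> e; rewrite /seq_val !big_nil ffunE.
have lE : level (seq_val (x :: r)) = level (val x) + level (seq_val r).
  by rewrite /seq_val big_cons.
have wE e : (val (seq_val (x :: r))).2 e = (val (val x)).2 e + (val (seq_val r)).2 e.
  by rewrite /seq_val big_cons /= ffunE.
set w := (val (val x)).2 in wE; set L := level (val x) in lE.
have pw : polytope closed L w := valP (val x).
have L12 : 0 < L <= 2 by have := valP x; rewrite -/L; case/orP => /eqP ->.
have step : cong (mon (seq_mon (x :: r))) (genmon L w * lists_mon s2 s1)%R.
  have [y yx ->] := genmonP pw L12.
  have -> : y = x by apply: val_inj; apply: val_inj; rewrite yx [RHS]surjective_pairing.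
  by rewrite mon_cons; exact: congruentMl cr.
clearbody L w.
have [L2|L1] : L = 2 \/ L = 1 by move: L12; clear; lia.
  rewrite L2 in pw step lE; exists (w :: s2), s1; split=> [|||| e].
  - by rewrite /= p2 pw.
  - by split.
  - have -> : lists_mon (w :: s2) s1 = (genmon 2 w * lists_mon s2 s1)%R := prod2_cons _ _ _ _ _.
    exact: step.
  - by rewrite lE lr mulnS addnA.
  - by rewrite wE wr big_cons addnA.
case: s1 p1 sz cr lr wr step => [|w1 [|//]] p1 _ cr lr wr step.
  rewrite L1 in pw step lE; exists s2, [:: w]; split=> [|||| e].
  - exact: p2.
  - by rewrite /= pw.
  - have -> : lists_mon s2 [:: w] = (genmon 1 w * lists_mon s2 [::])%R := prod2_seq1 _ _ _ _.
    exact: step.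
  - by rewrite lE lr addn0 addnC.
  - by rewrite wE wr big_nil big_seq1 addn0 addnC.
have pw1 : polytope closed 1 w1 by move: p1; rewrite /= andbT.
rewrite L1 in pw step.
exists (add_wt w w1 :: s2), [::]; split=> [|||| e].
- by rewrite /= p2 andbT; exact: polytopeD pw pw1.
- by [].
- apply: congruent_trans step _; apply: congruent_merge; exact: genmon1_cong.
- by rewrite lE lr L1 /= mulnS; clear; lia.
- by rewrite wE wr !big_cons !big_nil ffunE; clear; lia.
Qed.

Section Lists.
Variables (a b : nat).

Definition list_level (k : 'I_a + 'I_b) : nat := if k is inl _ then 2 else 1.

Definition list_table (s2 s1 : seq W) : {ffun 'I_a + 'I_b -> W} :=
  [ffun k : 'I_a + 'I_b => match k with
             | inl i => nth (zero_wt G) s2 i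
             | inr i => nth (zero_wt G) s1 i
             end].

Lemma big_list_table (R : Type) (idx : R) (op : Monoid.com_law idx) (F : nat -> W -> R)
    (s2 s1 : seq W) : size s2 = a -> size s1 = b ->
  \big[op/idx]_k F (list_level k) (list_table s2 s1 k) =
  op (\big[op/idx]_(w <- s2) F 2 w) (\big[op/idx]_(w <- s1) F 1 w).
Proof.
move=> sa sb; rewrite big_sumType /=; congr (op _ _).
  rewrite [RHS](big_nth (zero_wt G)) sa big_mkord; apply: eq_bigr => i _.
  by rewrite ffunE.
rewrite [RHS](big_nth (zero_wt G)) sb big_mkord; apply: eq_bigr => i _.
by rewrite ffunE.
Qed.

Lemma list_table_valid s2 s1 : size s2 = a -> size s1 = b ->
    all (polytope closed 2) s2 -> all (polytope closed 1) s1 ->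
  forall k, polytope closed (list_level k) (list_table s2 s1 k).
Proof.
by move=> sa sb /all_nthP p2 /all_nthP p1 [i|i]; rewrite ffunE /=; [apply: p2|apply: p1];
  rewrite ?sa ?sb.
Qed.

End Lists.

Lemma seq_cong r r' : seq_val r = seq_val r' -> cong (mon (seq_mon r)) (mon (seq_mon r')).
Proof.
move=> rr; have [s2 [s1 [p2 [p1 sz] c l s]]] := normal_form r.
have [s2' [s1' [p2' [p1' sz'] c' l' s']]] := normal_form r'.
apply: (congruent_trans c); apply: congruent_trans (congruent_sym c').
have ll : 2 * size s2 + size s1 = 2 * size s2' + size s1' by rewrite -l -l' rr.
(* The common level fixes the shape of the table: the number of rows of level 1 is its parity. *)
have [sz2 sz1] : size s2' = size s2 /\ size s1' = size s1.
  by move: ll sz sz'; clear; lia.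
rewrite /lists_mon /prod2 -!(@big_list_table (size s2) (size s1)) //.
apply: conn_same_sums_cong.
- by case.
- exact: list_table_valid.
- exact: list_table_valid.
move=> e; rewrite !(@big_list_table (size s2) (size s1) _ _ _ (fun _ w => w e)) //.
by apply: etrans (esym (s e)) (etrans _ (s' e)); rewrite rr.
Qed.

(** Choose a monomial [rep b] over each block [b], and let [psi] be the linear map sending [b] to
    it. Each monomial is congruent to the representative of its value, so [p] is congruent to
    [psi (phi p)], which is 0 on the kernel. *)
Lemma kernel_presentation p : phi p = 0%R <-> in_ideal_gen low_relation p.
Proof.
split=> [p0|pI]; last first.
  have : cong p 0%R by rewrite /congruent subr0.
  by move=> /cong_phi ->; rewrite -(subrr 0%R) phiB subrr.
have ex (b : B) : exists m, mon_val m == << b >>%R.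
  by have [r ->] := seq_val_surj b; exists (seq_mon r); rewrite mon_val_seq.
pose rep b := xchoose (ex b).
pose psi := mmap (@malgC M C) (fun b => mon (rep b)).
have congrep m : exists2 b, mon_val m = << b >>%R & cong (mon m) (mon (rep b)).
  have [r ->] := seq_monP m; exists (seq_val r); first exact: mon_val_seq.
  have [r' rE] := seq_monP (rep (seq_val r)); rewrite rE; apply: seq_cong.
  have := xchooseP (ex (seq_val r)); rewrite -/(rep _) rE mon_val_seq => /eqP /monom_inj.
  exact: esym.
suff : cong p (psi (phi p)) by rewrite p0 /psi mmap0 /congruent subr0.
rewrite /congruent {1}[p]monalgE.
have -> : psi (phi p) = (\sum_(m <- msupp p) psi (phi << p@_m *g m >>))%R.
  rewrite {1}[p]monalgE phi_sum.
  exact: (raddf_sum (mmap (@malgC M C) (fun b => mon (rep b)))).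
rewrite -sumrB; apply: in_ideal_gen_sum => m.
have [b vb cb] := congrep m.
rewrite phiU vb malgC_monom /psi mmapU -malgC_monom.
exact: congruentMl cb.
Qed.

End Presentation.

Theorem theorem1p4 (R : realType)
    (T : nat -> trigraph) (l : forall n : nat, edge (T n))
    (hT : forall n : nat, 3 <= n -> trivalent_tree (T n) n /\ is_leaf (l n))
    (g n : nat) (hgn : 2 < 2 * g + n) :
  let G := Gamma l g n in
  let closed := n == 0 in
  let S := gen_poly (complex R) G closed in
  let phi := @natural_map (complex R) G closed in
  (forall y : semigroup_alg (complex R) G closed, exists p : S, phi p = y) /\
  exists X : S -> Prop,
    (forall f : S, X f -> exists d : nat, d <= 4 /\ homogeneous d f) /\
    (forall p : S, phi p = 0%R <-> in_ideal_gen X p).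
Proof.
have dec := Gamma_decomposable hT hgn.
move=> G closed S phi; split; first exact: phi_surj dec.
exists (@low_relation (complex R) G closed); split; last exact: kernel_presentation dec.
by move=> f [_ ?].
Qed.
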